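(* Let $f_1,\dots,f_n:\mathbb{R}\to\mathbb{R}$, the weighted digraph $\mathcal{G}$ with Laplacian $\mathcal{L}\in\mathbb{R}^{n\times n}$, and the real parameters $\alpha,\beta,\gamma,\delta$ (with derived parameters $\zeta,\eta$) be as in the context, satisfying the standing assumptions listed there, and let $\rho\ge0$. If there exist $P,Q\in\mathbb{R}^{2\times2}$ (symmetric) and $\lambda_0,\lambda_1\in\mathbb{R}$, with $P,Q\succ0$ and $\lambda_0,\lambda_1\ge0$, such that $$\begin{bmatrix}\star\end{bmatrix}^{\top}\begin{bmatrix}P&0&0\\0&-\rho^2P&0\\0&0&\lambda_0M_0\end{bmatrix}\begin{bmatrix}A_p&B_{pu}\\ I_2&0\\ C_x&D_{xu}\\ 0&1\end{bmatrix}\preceq0$$ and $$\begin{bmatrix}\star\end{bmatrix}^{\top}\begin{bmatrix}Q&0&0&0\\0&-\rho^2Q&0&0\\0&0&\lambda_0M_0&0\\0&0&0&\lambda_1M_1\end{bmatrix}\begin{bmatrix}A_q&B_{qu}&B_{qv}\\ I_2&0&0\\ C_x&D_{xu}&D_{xv}\\ 0&1&0\\ C_y&D_{yu}&D_{yv}\\ 0&0&1\end{bmatrix}\preceq0,$$ where $[\star]^\top A X$ denotes $X^\top A X$ and the matrices are defined in the context, then the trajectories of the system $G_m$ (defined in the context) satisfy $$\left\|\begin{bmatrix}w_1^k-w_1^\star\\ \hat w_2^k-\hat w_2^\star\end{bmatrix}\right\|\le\sqrt{\operatorname{cond}(T)}\,\rho^k\left\|\begin{bmatrix}w_1^0-w_1^\star\\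 \hat w_2^0-\hat w_2^\star\end{bmatrix}\right\|$$ for all $k\ge 0$, for a fixed point $(w_1^\star,\hat w_2^\star,x^\star,\hat y^\star,u^\star,v^\star)$ of $G_m$, where $T=P\otimes\Pi+Q\otimes(I-\Pi)$ and $\operatorname{cond}(T)=\lambda_{\max}(T)/\lambda_{\min}(T)$ is the condition number of $T$. Thus the output $x^k$ of Algorithm 1 (defined in the context) converges to the optimizer with the linear rate $\rho$, i.e. for any initialization $w_1^0,w_2^0\in\mathbb{R}^n$ there is a constant $C$ independent of $k$ with $\|x^k-\mathbb{1}x_{\mathrm{opt}}\|\le C\rho^k$ for all $k\ge0$.
   Context: Notation: $\mathbb{1}\in\mathbb{R}^n$ is the all-ones column vector, $I$ is the $n\times n$ identity, $I_2$ the $2\times 2$ identity, $\Pi=\frac1n\mathbb{1}\mathbb{1}^{\top}$, $\otimes$ is the Kronecker product, $\|\cdot\|$ is the Euclidean norm of vectors and the spectral norm of matrices, and $0^0=1$. The local decision variables are scalars (dimension $d=1$, taken without loss of generality). For $x=(x_1,\dots,x_n)^\top\in\mathbb{R}^n$, $\nabla F(x)=(\nabla f_1(x_1),\dots,\nabla f_n(x_n))^\top$. Graph: $\mathcal{G}=(\{1,\dots,n\},\mathcal{E})$ is a weighted digraph, where $(i,j)\in\mathcal{E}$ means node $i$ can receive information from node $j$. Its weighted Laplacian $\mathcal{L}\in\mathbb{R}^{n\times n}$ has $-\mathcal{L}_{ij}$ equal to the weight on edge $(i,j)$ if $(i,j)\in\mathcal{E}$, $\mathcal{L}_{ij}=0$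 if $(i,j)\notin\mathcal{E}$ and $i\ne j$, and $\mathcal{L}_{ii}=-\sum_{j\neq i}\mathcal{L}_{ij}$, so that $\mathcal{L}\mathbb{1}=0$. Standing assumptions. (1) Each $f_i$ is convex and differentiable, and the minimizer $x_{\mathrm{opt}}=\operatorname{arg\,min}_\theta\sum_i f_i(\theta)$ (the optimizer) is assumed to exist and be unique; it satisfies $\sum_{i=1}^n\nabla f_i(x_{\mathrm{opt}})=0$. For given constants $0<m\le L$, the local gradients are sector bounded: for all $i$ and all $x_i\in\mathbb{R}$, $$\begin{bmatrix} x_i-x_{\mathrm{opt}}\\ \nabla f_i(x_i)-\nabla f_i(x_{\mathrm{opt}})\end{bmatrix}^{\top}M_0\begin{bmatrix} x_i-x_{\mathrm{opt}}\\ \nabla f_i(x_i)-\nabla f_i(x_{\mathrm{opt}})\end{bmatrix}\ge 0,\qquad M_0=\begin{bmatrix}-2mL & L+m\\ L+m & -2\end{bmatrix}.$$ (2) $\mathcal{G}$ is strongly connected. (3) $\mathcal{G}$ is weight balanced: $\mathbb{1}^{\top}\mathcal{L}=0$. (4) $\sigma:=\|I-\Pi-\mathcal{L}\|<1$. Parameters: $\alpha,\beta,\gamma,\delta\in\mathbb{R}$ with $\gamma^2\ge 4\beta\delta$. Define $\zeta=\beta/\gamma$ if $\delta=0$ and $\zeta=\frac{\gamma-\sqrt{\gamma^2-4\beta\delta}}{2\delta}$ otherwise, and $\eta=\gamma-\delta\zeta$. Matrices: $$A_p=\begin{bmatrix}1&0\\0&0\end{bmatrix},\quad B_{pu}=\begin{bmatrix}-\alpha\\0\end{bmatrix},\quad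 A_q=\begin{bmatrix}1&0\\1&1\end{bmatrix},\quad B_{qu}=\begin{bmatrix}-\alpha\\0\end{bmatrix},\quad B_{qv}=\begin{bmatrix}-\zeta\\-1\end{bmatrix},$$ $$C_x=\begin{bmatrix}1&0\end{bmatrix},\quad D_{xu}=0,\quad D_{xv}=-1,\quad C_y=\begin{bmatrix}\delta&\eta\end{bmatrix},\quad D_{yu}=0,\quad D_{yv}=0,\quad M_1=\begin{bmatrix}\sigma^2-1&1\\1&-1\end{bmatrix}.$$ System $G_m$ (in feedback with the gradients and the Laplacian), all signals in $\mathbb{R}^n$: $$\begin{aligned} w_1^{k+1} &= w_1^k-\alpha u^k-\zeta v^k,\\ \hat w_2^{k+1} &= (I-\Pi)w_1^k+(I-\Pi)\hat w_2^k-(I-\Pi)v^k,\\ x^k &= w_1^k-v^k,\\ \hat y^k &= \delta w_1^k+\eta\hat w_2^k,\\ u^k &= \nabla F(x^k),\\ v^k &= \mathcal{L}\hat y^k. \end{aligned}$$ It is obtained from Algorithm 1 below by the substitution $\hat w_2^k=(I-\Pi)w_2^k$. A fixed point is a tuple $(w_1^\star,\hat w_2^\star,x^\star,\hat y^\star,u^\star,v^\star)$ of vectors in $\mathbb{R}^n$ satisfying all six equations when every time-indexed signal (at times $k$ and $k+1$) is replaced by its starred value. Algorithm 1 (self-healing distributed gradient descent): from arbitrary $w_1^0,w_2^0\in\mathbb{R}^n$, for $k=0,1,2,\dots$, $$\begin{aligned} y^k&=\delta w_1^k+\eta w_2^k, & v^k&=\mathcal{L}y^k, & x^k&=w_1^k-v^k,\\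 u^k&=\nabla F(x^k), & w_1^{k+1}&=w_1^k-\alpha u^k-\zeta v^k, & w_2^{k+1}&=w_1^k+w_2^k-v^k. \end{aligned}$$
   Formalization: A fixed point of G_m is asserted to exist only for ρ ≤ 1 (for ρ > 1 one may fail to exist, e.g. when ζ = 0); the norm bound is proved for every fixed point and the rate for x^k holds for all ρ ≥ 0. *)

(* Defs.v *)
From HB Require Import structures.
From mathcomp Require Import all_boot all_order all_algebra.
From mathcomp Require Import mxtens.
From mathcomp Require Import all_classical all_reals all_analysis.

Set Implicit Arguments.
Unset Strict Implicit.
Unset Printing Implicit Defensive.

Import Order.TTheory GRing.Theory Num.Theory.
Import numFieldNormedType.Exports.
Local Open Scope classical_set_scope.
Local Open Scope ring_scope.

(* The canonical norm `|_| on matrices is the sup norm, hence the explicit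
   Euclidean norm and the matrix norm it induces. *)
Definition enorm (R : realType) (n : nat) (x : 'cV[R]_n) : R :=
  Num.sqrt (\sum_(i < n) x i 0 ^+ 2).

Definition spectral_norm (R : realType) (m n : nat) (A : 'M[R]_(m, n)) : R :=
  sup [set enorm (A *m x) | x in [set x : 'cV[R]_n | enorm x <= 1]].

Definition posdefmx (R : realType) (n : nat) (A : 'M[R]_n) : Prop :=
  A^T = A /\ forall x : 'cV[R]_n, x != 0 -> 0 < (x^T *m A *m x) 0 0.

Definition negsemidefmx (R : realType) (n : nat) (A : 'M[R]_n) : Prop :=
  A^T = A /\ forall x : 'cV[R]_n, (x^T *m A *m x) 0 0 <= 0.

(* Only meaningful when the spectrum is real, e.g. for symmetric matrices. *)
Definition lambda_max (R : realType) (n : nat) (A : 'M[R]_n) : R :=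
  sup [set a | eigenvalue A a].

Definition lambda_min (R : realType) (n : nat) (A : 'M[R]_n) : R :=
  inf [set a | eigenvalue A a].

Definition condnum (R : realType) (n : nat) (A : 'M[R]_n) : R :=
  lambda_max A / lambda_min A.

Definition congrmx (R : realType) (m n : nat) (A : 'M[R]_m) (X : 'M[R]_(m, n)) :
  'M[R]_n := X^T *m A *m X.

Definition diag2 (R : realType) (m n : nat) (A : 'M[R]_m) (B : 'M[R]_n) :
  'M[R]_(m + n) := block_mx A 0 0 B.

Definition mx22 (R : realType) (a b c d : R) : 'M[R]_2 :=
  block_mx a%:M b%:M c%:M d%:M : 'M[R]_(1 + 1).

Definition col2 (R : realType) (a b : R) : 'cV[R]_2 :=
  col_mx a%:M b%:M : 'cV[R]_(1 + 1).

Definition row2 (R : realType) (a b : R) : 'rV[R]_2 :=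
  row_mx a%:M b%:M : 'rV[R]_(1 + 1).

Definition ones (R : realType) (n : nat) : 'cV[R]_n := const_mx 1.
Arguments ones {R n}.

Definition avg (R : realType) (n : nat) : 'M[R]_n :=
  n%:R^-1 *: (ones *m ones^T).
Arguments avg {R n}.

(* [wd_edge G i j] means that node i can receive information from node j.
   The weights are arbitrary reals, only relevant on edges; a self-loop does
   not contribute to the Laplacian. *)
Record wdigraph (R : realType) (n : nat) := WDigraph {
  wd_edge : rel 'I_n;
  wd_weight : 'I_n -> 'I_n -> R
}.

Definition laplacian (R : realType) (n : nat) (G : wdigraph R n) : 'M[R]_n :=
  let W i j := if wd_edge G i j then wd_weight G i j else 0 in
  \matrix_(i, j) if i == j then \sum_(k | k != i) W i k else - W i j.

Definition strongly_connected (R : realType) (n : nat) (G : wdigraph R n) :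
  Prop := forall i j, connect (wd_edge G) i j.

Definition weight_balanced (R : realType) (n : nat) (G : wdigraph R n) :
  Prop := ones^T *m laplacian G = 0.

Definition unique_minimizer (R : realType) (n : nat) (f : 'I_n -> R -> R)
    (xopt : R) : Prop :=
  let F t := \sum_(i < n) f i t in
  forall z, (forall t, F z <= F t) <-> z = xopt.

Definition M0 (R : realType) (m L : R) : 'M[R]_2 :=
  mx22 (- (2 * m * L)) (L + m) (L + m) (- 2).

Definition sector_bounded (R : realType) (m L xopt : R) (f : R -> R) : Prop :=
  forall x, let z := col2 (x - xopt) (derive1 f x - derive1 f xopt) in
    0 <= (z^T *m M0 m L *m z) 0 0.

Definition grad (R : realType) (n : nat) (f : 'I_n -> R -> R) (x : 'cV[R]_n) :
  'cV[R]_n := \col_i derive1 (f i) (x i 0).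

(* When gamma = delta = 0, beta / gamma is undefined on paper and is 0 here. *)
Definition zeta_of (R : realType) (beta gamma delta : R) : R :=
  if delta == 0 then beta / gamma
  else (gamma - Num.sqrt (gamma ^+ 2 - 4 * beta * delta)) / (2 * delta).

Definition eta_of (R : realType) (beta gamma delta : R) : R :=
  gamma - delta * zeta_of beta gamma delta.

Section Matrices.
Variables (R : realType) (alpha zeta delta eta sigma : R).

Definition Ap : 'M[R]_2 := mx22 1 0 0 0.
Definition Bpu : 'cV[R]_2 := col2 (- alpha) 0.
Definition Aq : 'M[R]_2 := mx22 1 0 1 1.
Definition Bqu : 'cV[R]_2 := col2 (- alpha) 0.
Definition Bqv : 'cV[R]_2 := col2 (- zeta) (- 1).
Definition Cx : 'rV[R]_2 := row2 1 0.
Definition Dxu : 'M[R]_1 := 0.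
Definition Dxv : 'M[R]_1 := - 1%:M.
Definition Cy : 'rV[R]_2 := row2 delta eta.
Definition Dyu : 'M[R]_1 := 0.
Definition Dyv : 'M[R]_1 := 0.
Definition M1 : 'M[R]_2 := mx22 (sigma ^+ 2 - 1) 1 1 (- 1).

Definition outer_p : 'M[R]_(2 + (2 + (1 + 1)), 2 + 1) :=
  col_mx (row_mx Ap   Bpu)
 (col_mx (row_mx 1%:M 0)
 (col_mx (row_mx Cx   Dxu)
         (row_mx 0    1%:M))).

Definition outer_q : 'M[R]_(2 + (2 + ((1 + 1) + (1 + 1))), 2 + (1 + 1)) :=
  col_mx (row_mx Aq   (row_mx Bqu  Bqv))
 (col_mx (row_mx 1%:M (row_mx 0    0))
 (col_mx (col_mx (row_mx Cx   (row_mx Dxu  Dxv))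
                 (row_mx 0    (row_mx 1%:M 0)))
         (col_mx (row_mx Cy   (row_mx Dyu  Dyv))
                 (row_mx 0    (row_mx 0    1%:M))))).

Definition lmi_p (rho m L lambda0 : R) (P : 'M[R]_2) : 'M[R]_(2 + 1) :=
  congrmx (diag2 P (diag2 (- (rho ^+ 2 *: P)) (lambda0 *: M0 m L))) outer_p.

Definition lmi_q (rho m L lambda0 lambda1 : R) (Q : 'M[R]_2) :
    'M[R]_(2 + (1 + 1)) :=
  congrmx
    (diag2 Q (diag2 (- (rho ^+ 2 *: Q))
                    (diag2 (lambda0 *: M0 m L) (lambda1 *: M1))))
    outer_q.

End Matrices.

(* The tuple of signals at one time; also used for the algorithm itself, where
   [w2] and [y] stand for the unhatted signals. *)
Record signals (R : realType) (n : nat) := Signals {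
  sig_w1 : 'cV[R]_n;
  sig_w2 : 'cV[R]_n;
  sig_x : 'cV[R]_n;
  sig_y : 'cV[R]_n;
  sig_u : 'cV[R]_n;
  sig_v : 'cV[R]_n
}.

Definition state (R : realType) (n : nat) (s : signals R n) : 'cV[R]_(n + n) :=
  col_mx (sig_w1 s) (sig_w2 s).

Section Systems.
Variables (R : realType) (n : nat) (f : 'I_n -> R -> R) (Lap : 'M[R]_n).
Variables (alpha zeta delta eta : R).

(* [s] holds the signals at time k and [s'] those at time k + 1. *)
Definition Gm_eqs (s s' : signals R n) : Prop :=
  [/\ sig_w1 s' = sig_w1 s - alpha *: sig_u s - zeta *: sig_v s,
      sig_w2 s' = (1%:M - avg) *m sig_w1 s + (1%:M - avg) *m sig_w2 s
                  - (1%:M - avg) *m sig_v s,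
      sig_x s = sig_w1 s - sig_v s,
      sig_y s = delta *: sig_w1 s + eta *: sig_w2 s &
      sig_u s = grad f (sig_x s) /\ sig_v s = Lap *m sig_y s].

Definition Gm_trajectory (s : nat -> signals R n) : Prop :=
  forall k, Gm_eqs (s k) (s k.+1).

Definition Gm_fixed_point (s : signals R n) : Prop := Gm_eqs s s.

Definition alg1_eqs (s s' : signals R n) : Prop :=
  [/\ sig_y s = delta *: sig_w1 s + eta *: sig_w2 s /\ sig_v s = Lap *m sig_y s,
      sig_x s = sig_w1 s - sig_v s,
      sig_u s = grad f (sig_x s),
      sig_w1 s' = sig_w1 s - alpha *: sig_u s - zeta *: sig_v s &
      sig_w2 s' = sig_w1 s + sig_w2 s - sig_v s].

Definition alg1_run (s : nat -> signals R n) : Prop :=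
  forall k, alg1_eqs (s k) (s k.+1).

End Systems.

(* Main.v *)
Require Import Defs.
From HB Require Import structures.
From mathcomp Require Import all_boot all_order all_algebra.
From mathcomp Require Import mxtens.
From mathcomp Require Import all_classical all_reals all_analysis.
From mathcomp Require Import ring lra.

Set Implicit Arguments.
Unset Strict Implicit.
Unset Printing Implicit Defensive.

Import Order.TTheory GRing.Theory Num.Theory.
Import numFieldNormedType.Exports.
Local Open Scope classical_set_scope.
Local Open Scope ring_scope.

(** Write every signal in R^n as its mean along the all-ones vector plus a
    deviation of zero mean. The matrix [T = P (x) Pi + Q (x) (I - Pi)] measures
    a state error by [P] on its means and by [Q] on its deviations; call the
    resulting quadratic form [V] ([lyapunov]). The Laplacian does not act on
    means, so these evolve by the two-dimensional model of the first LMI, while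
    each coordinate of the deviations evolves by that of the second. Evaluate
    the first LMI at the means and the second at every coordinate of the
    deviations, and add everything up. By orthogonality of means and deviations
    the two multipliers of [lambda0] recombine into the sum over the agents of
    the sector forms, which is nonnegative, and the multiplier of [lambda1]
    becomes [sigma^2 |y|^2 - |(I - Pi - Lap) y|^2], nonnegative by definition of
    [sigma]. What remains is [V(next) <= rho^2 V] ([lyapunov_dissipation]).

    The extreme Rayleigh quotients of [V] are eigenvalues of [T]
    ([tens_rayleigh_bounds]), so passing from [V] to the Euclidean norm costs
    the square root of the condition number ([Gm_linear_rate]). A fixed point
    has its output at the optimizer if [alpha] is nonzero, which is where the
    sector condition can be used; if [alpha = 0] the gradients do not influence
    the state, and an input satisfying the sector condition may be substituted
    ([fixed_point_sector]).

    If [rho <= 1], the LMIs exclude [eta = 0], and [zeta = 0] unless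
    [alpha = 0]: otherwise the disagreement model would have a nonzero rest
    point at which the second LMI is maximal with a nonzero slope
    ([lmi_q_eta_neq0], [lmi_q_zeta_neq0]). This is what is needed to solve the
    fixed point equations with output at the optimizer
    ([optimal_fixed_point]), and the rate of the algorithm follows. If
    [rho > 1] a fixed point may be missing; the consensus state at the optimizer
    then serves as a reference, since it is at rest up to a constant
    perturbation, whose accumulated effect grows no faster than [rho^k]
    ([Gm_output_rate_gt1]). *)

(** * Quadratic forms in two variables and the scalar form of the LMIs *)

Definition qform (R : realType) (A : 'M[R]_2) (a b : R) : R :=
  ((col2 a b)^T *m A *m col2 a b) 0 0.

Lemma col2E0 (R : realType) (a b : R) : col2 a b 0 0 = a.
Proof.
rewrite (_ : 0 = lshift 1 0 :> 'I_(1 + 1)); last exact: val_inj.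
by apply: etrans (col_mxEu a%:M b%:M 0 0) _; rewrite mxE mulr1n.
Qed.

Lemma col2E1 (R : realType) (a b : R) : col2 a b 1 0 = b.
Proof.
rewrite (_ : 1 = rshift 1 0 :> 'I_(1 + 1)); last exact: val_inj.
by apply: etrans (col_mxEd a%:M b%:M 0 0) _; rewrite mxE mulr1n.
Qed.

Lemma sum_ord2 (R : realType) (F : 'I_2 -> R) : \sum_(i < 2) F i = F 0 + F 1.
Proof.
by rewrite !big_ord_recl big_ord0 addr0; congr (_ + F _); apply: val_inj.
Qed.

Lemma qformE (R : realType) (A : 'M[R]_2) (a b : R) :
  qform A a b = A 0 0 * a ^+ 2 + (A 0 1 + A 1 0) * (a * b) + A 1 1 * b ^+ 2.
Proof.
rewrite /qform; have := (col2E0 a b, col2E1 a b).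
move: (col2 a b) => x [<- <-]; rewrite !mxE sum_ord2 !mxE !sum_ord2 !mxE; ring.
Qed.

Lemma col2_eq0 (R : realType) (a b : R) :
  (col2 a b == 0) = (a == 0) && (b == 0).
Proof.
apply/eqP/andP => [h|[/eqP-> /eqP->]].
  have := (col2E0 a b, col2E1 a b); rewrite h !mxE => -[<- <-].
  by rewrite eqxx.
by rewrite /col2 !raddf0 col_mx0.
Qed.

Lemma mx22E (R : realType) (a b c d : R) :
  [/\ mx22 a b c d 0 0 = a, mx22 a b c d 0 1 = b,
      mx22 a b c d 1 0 = c & mx22 a b c d 1 1 = d].
Proof.
rewrite (_ : 0 = lshift 1 0 :> 'I_(1 + 1)); last exact: val_inj.
rewrite (_ : 1 = rshift 1 0 :> 'I_(1 + 1)); last exact: val_inj.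
have sE (t : R) : (t%:M : 'M[R]_1) 0 0 = t by rewrite mxE mulr1n.
split.
- exact: etrans (block_mxEul a%:M b%:M c%:M d%:M 0 0) (sE _).
- exact: etrans (block_mxEur a%:M b%:M c%:M d%:M 0 0) (sE _).
- exact: etrans (block_mxEdl a%:M b%:M c%:M d%:M 0 0) (sE _).
- exact: etrans (block_mxEdr a%:M b%:M c%:M d%:M 0 0) (sE _).
Qed.

Lemma qform_mx22 (R : realType) (a b c d x y : R) :
  qform (mx22 a b c d) x y = a * x ^+ 2 + (b + c) * (x * y) + d * y ^+ 2.
Proof. by rewrite qformE; have [-> -> -> ->] := mx22E a b c d. Qed.

Lemma qform_M0E (R : realType) (m L x u : R) :
  qform (M0 m L) x u = - (2 * m * L) * x ^+ 2 + 2 * (L + m) * (x * u)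
                       - 2 * u ^+ 2.
Proof. by rewrite qform_mx22; ring. Qed.

(** For [v] the output of the Laplacian on [y], [y - v] is the image of [y]
    under the disagreement operator, so the form measures how far that operator
    stays below the gain [sigma]. *)
Lemma qform_M1E (R : realType) (sigma y v : R) :
  qform (M1 sigma) y v = sigma ^+ 2 * y ^+ 2 - (y - v) ^+ 2.
Proof. by rewrite qform_mx22; ring. Qed.

Lemma qform_gt0 (R : realType) (A : 'M[R]_2) (a b : R) :
  posdefmx A -> (a != 0) || (b != 0) -> 0 < qform A a b.
Proof.
by case=> _ Apos h; apply: Apos; rewrite col2_eq0 negb_and.
Qed.

Lemma qform_ge0 (R : realType) (A : 'M[R]_2) (a b : R) :
  posdefmx A -> 0 <= qform A a b.
Proof.
move=> Apd; have [h|] := boolP ((a != 0) || (b != 0)).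
  exact/ltW/qform_gt0.
rewrite negb_or !negbK => /andP[/eqP-> /eqP->]; rewrite qformE; lra.
Qed.

Lemma quad_diag2 (R : realType) (p q : nat) (A : 'M[R]_p) (B : 'M[R]_q)
    (x : 'cV[R]_p) (y : 'cV[R]_q) :
  ((col_mx x y)^T *m diag2 A B *m col_mx x y) 0 0
  = (x^T *m A *m x) 0 0 + (y^T *m B *m y) 0 0.
Proof.
rewrite /diag2 tr_col_mx mul_row_block !mulmx0 addr0 add0r mul_row_col.
by rewrite mxE.
Qed.

Lemma quad_congrmx (R : realType) (p q : nat) (A : 'M[R]_p)
    (X : 'M[R]_(p, q)) (x : 'cV[R]_q) :
  x^T *m congrmx A X *m x = (X *m x)^T *m A *m (X *m x).
Proof. by rewrite /congrmx trmx_mul !mulmxA. Qed.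

Lemma quad_scale (R : realType) (p : nat) (c : R) (A : 'M[R]_p)
    (x : 'cV[R]_p) :
  (x^T *m (c *: A) *m x) 0 0 = c * (x^T *m A *m x) 0 0.
Proof. by rewrite -scalemxAr -scalemxAl mxE. Qed.

Lemma mul_mx22_col2 (R : realType) (a b c d x y : R) :
  mx22 a b c d *m col2 x y = col2 (a * x + b * y) (c * x + d * y).
Proof.
pose S := 'M[R]_1.
apply: etrans (mul_block_col (a%:M : S) (b%:M : S) (c%:M : S) (d%:M : S)
  (x%:M : S) (y%:M : S)) _.
by rewrite -!scalar_mxM -!raddfD.
Qed.

Lemma mul_row2_col2 (R : realType) (a b x y : R) :
  row2 a b *m col2 x y = (a * x + b * y)%:M.
Proof.
pose S := 'M[R]_1.
apply: etrans (mul_row_col (a%:M : S) (b%:M : S) (x%:M : S) (y%:M : S)) _.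
by rewrite -!scalar_mxM -raddfD.
Qed.

Lemma mul_col2_scalar (R : realType) (a b x : R) :
  col2 a b *m (x%:M : 'M[R]_1) = col2 (a * x) (b * x).
Proof.
pose S := 'M[R]_1.
by apply: etrans (mul_col_mx (a%:M : S) (b%:M : S) (x%:M : S)) _;
  rewrite -!scalar_mxM.
Qed.

Lemma add_col2 (R : realType) (a b c d : R) :
  col2 a b + col2 c d = col2 (a + c) (b + d).
Proof.
pose S := 'M[R]_1.
by apply: etrans (add_col_mx (a%:M : S) (b%:M : S) (c%:M : S) (d%:M : S)) _;
  rewrite -!raddfD.
Qed.

(** The stacked pairs of rows of the LMIs have height [1 + 1], while the blocks
    of their middle matrices have size [2]; the two sizes are convertible but
    not syntactically equal. *)
Lemma mul_rows2 (R : realType) (k : nat) (r1 r2 : 'rV[R]_k) (x : 'cV[R]_k)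
    (p q : R) :
  r1 *m x = p%:M -> r2 *m x = q%:M ->
  (col_mx r1 r2 : 'M[R]_(2, k)) *m x = col2 p q.
Proof.
by move=> e1 e2; apply: etrans (mul_col_mx r1 r2 x) _; rewrite e1 e2.
Qed.

(** The vector [(a, b, u)] is a consensus state with its input: the form is the
    dissipation [V(next) - rho^2 V] plus the sector multiplier. *)
Lemma lmi_p_scalar (R : realType) (alpha rho m L lambda0 : R) (P : 'M[R]_2) :
  negsemidefmx (lmi_p alpha rho m L lambda0 P) -> forall a b u : R,
  qform P (a - alpha * u) 0 - rho ^+ 2 * qform P a b
    + lambda0 * qform (M0 m L) a u <= 0.
Proof.
case=> _ H a b u; have := H (col_mx (col2 a b) (u%:M : 'M[R]_1)).
rewrite /lmi_p quad_congrmx /outer_p !mul_col_mx.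
rewrite (@mul_rows2 _ _ _ _ _ a u); first last.
- by rewrite mul_row_col mul0mx mul1mx add0r.
- by rewrite mul_row_col /Cx mul_row2_col2 mul0mx mul1r mul0r !addr0.
rewrite !mul_row_col /Ap /Bpu mul_mx22_col2 mul_col2_scalar add_col2.
rewrite mul0mx mul1mx addr0 !quad_diag2 -scaleNr !quad_scale.
rewrite -!/(qform _ _ _) => h.
have -> : a - alpha * u = 1 * a + 0 * b + - alpha * u by ring.
rewrite -mulNr; apply: le_trans h; rewrite le_eqVlt; apply/orP; left; apply/eqP.
rewrite addrA; congr (qform P _ _ + _ + _); ring.
Qed.

(** Same reading for the disagreement component, where [v] is a further input,
    [a - v] the local decision and [delta * a + eta * b] the transmitted
    signal. *)
Lemma lmi_q_scalar (R : realType)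
    (alpha zeta delta eta sigma rho m L lambda0 lambda1 : R) (Q : 'M[R]_2) :
  negsemidefmx (lmi_q alpha zeta delta eta sigma rho m L lambda0 lambda1 Q) ->
  forall a b u v : R,
  qform Q (a - alpha * u - zeta * v) (a + b - v) - rho ^+ 2 * qform Q a b
    + lambda0 * qform (M0 m L) (a - v) u
    + lambda1 * qform (M1 sigma) (delta * a + eta * b) v <= 0.
Proof.
case=> _ H a b u v.
have := H (col_mx (col2 a b) (col_mx (u%:M : 'M[R]_1) (v%:M : 'M[R]_1))).
rewrite /lmi_q quad_congrmx /outer_q !mul_col_mx.
rewrite (@mul_rows2 _ _ _ _ _ (a - v) u); first last.
- by rewrite !mul_row_col !mul0mx mul1mx add0r addr0.
- rewrite !mul_row_col /Cx mul_row2_col2 !mul0mx /Dxv mulNmx mul1mx.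
  by rewrite mul1r mul0r addr0 add0r raddfB.
rewrite (@mul_rows2 _ _ _ _ _ (delta * a + eta * b) v); first last.
- by rewrite !mul_row_col !mul0mx mul1mx !add0r.
- by rewrite !mul_row_col /Cy mul_row2_col2 !mul0mx !addr0.
rewrite !mul_row_col /Aq /Bqu /Bqv mul_mx22_col2 !mul_col2_scalar !add_col2.
rewrite !mul0mx mul1mx !addr0 !quad_diag2 -scaleNr !quad_scale.
rewrite -!/(qform _ _ _) => h.
have e1 : 1 * a + 0 * b + (- alpha * u + - zeta * v) = a - alpha * u - zeta * v.
  by ring.
have e2 : 1 * a + 1 * b + (0 * u + -1 * v) = a + b - v by ring.
by move: h; rewrite e1 e2 mulNr !addrA.
Qed.

(** * Means, deviations and the dissipation inequality *)

Definition mean (R : realType) (n : nat) (w : 'cV[R]_n) : R :=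
  n%:R^-1 * \sum_(i < n) w i 0.

Lemma avg_mulE (R : realType) (n p : nat) (w : 'M[R]_(n, p)) i j :
  (avg *m w) i j = n%:R^-1 * \sum_(k < n) w k j.
Proof.
rewrite /avg -scalemxAl mxE -mulmxA mxE big_ord1 !mxE mul1r.
by congr (_ * _); apply: eq_bigr => k _; rewrite !mxE mul1r.
Qed.

Lemma avg_mul_cV (R : realType) (n : nat) (w : 'cV[R]_n) i :
  (avg *m w) i 0 = mean w.
Proof. exact: avg_mulE. Qed.

Lemma dev_mul_cV (R : realType) (n : nat) (w : 'cV[R]_n) i :
  ((1%:M - avg) *m w) i 0 = w i 0 - mean w.
Proof. by rewrite mulmxBl mul1mx mxE [X in _ + X]mxE avg_mul_cV. Qed.

Lemma mean_sum (R : realType) (n : nat) (w : 'cV[R]_n) :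
  (0 < n)%N -> \sum_(i < n) w i 0 = n%:R * mean w.
Proof. by move=> n0; rewrite /mean mulrA mulfV ?mul1r // pnatr_eq0 -lt0n. Qed.

Lemma meanD (R : realType) (n : nat) (a b : 'cV[R]_n) :
  mean (a + b) = mean a + mean b.
Proof.
rewrite /mean -mulrDr -big_split; congr (_ * _).
by apply: eq_bigr => i _; rewrite mxE.
Qed.

Lemma meanZ (R : realType) (n : nat) c (a : 'cV[R]_n) :
  mean (c *: a) = c * mean a.
Proof.
rewrite /mean mulrCA; congr (_ * _); rewrite mulr_sumr.
by apply: eq_bigr => i _; rewrite mxE.
Qed.

Lemma meanB (R : realType) (n : nat) (a b : 'cV[R]_n) :
  mean (a - b) = mean a - mean b.
Proof. by rewrite meanD -scaleN1r meanZ mulN1r. Qed.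

Lemma mean_ones (R : realType) (n : nat) c :
  (0 < n)%N -> mean (c *: ones : 'cV[R]_n) = c.
Proof.
move=> n0; rewrite meanZ /mean (eq_bigr (fun=> 1)) => [|i _]; last first.
  by rewrite mxE.
by rewrite sumr_const card_ord mulVf ?mulr1 // pnatr_eq0 -lt0n.
Qed.

Lemma mean_balanced (R : realType) (n : nat) (Lap : 'M[R]_n) (y : 'cV[R]_n) :
  ones^T *m Lap = 0 -> mean (Lap *m y) = 0.
Proof.
move=> Lap1; have := congr1 (fun M : 'rV[R]_n => (M *m y) 0 0) Lap1.
rewrite /= -mulmxA mul0mx mxE [RHS]mxE => h; rewrite /mean.
rewrite (_ : \sum_i _ = 0) ?mulr0 //; rewrite -[RHS]h; apply: eq_bigr => i _.
by rewrite !mxE mul1r.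
Qed.

Lemma mean_dev (R : realType) (n : nat) (w : 'cV[R]_n) :
  (0 < n)%N -> mean ((1%:M - avg) *m w) = 0.
Proof.
move=> n0; rewrite mulmxBl mul1mx meanB.
rewrite (_ : avg *m w = mean w *: ones) ?mean_ones ?subrr //.
by apply/colP => i; rewrite avg_mul_cV !mxE mulr1.
Qed.

Lemma sum_dev (R : realType) (n : nat) (w : 'cV[R]_n) :
  (0 < n)%N -> \sum_(i < n) (w i 0 - mean w) = 0.
Proof.
move=> n0; rewrite sumrB mean_sum // sumr_const card_ord.
by rewrite -[mean w *+ n]mulr_natl subrr.
Qed.

(** Parallel-axis identity: the cross terms between means and deviations are
    linear in the deviations, which sum to zero. *)
Lemma sum_qform_split (R : realType) (n : nat) (A : 'M[R]_2) (a b : 'cV[R]_n) :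
  (0 < n)%N ->
  \sum_(i < n) qform A (a i 0) (b i 0)
  = \sum_(i < n) (qform A (mean a) (mean b)
                  + qform A (a i 0 - mean a) (b i 0 - mean b)).
Proof.
move=> n0; apply/eqP; rewrite -subr_eq0 -sumrB; apply/eqP.
pose p := 2 * A 0 0 * mean a + (A 0 1 + A 1 0) * mean b.
pose q := 2 * A 1 1 * mean b + (A 0 1 + A 1 0) * mean a.
rewrite (eq_bigr (fun i => p * (a i 0 - mean a) + q * (b i 0 - mean b))).
  by rewrite big_split /= -!mulr_sumr !sum_dev // !mulr0 addr0.
by move=> i _; rewrite !qformE /p /q; ring.
Qed.

Definition sqn (R : realType) (n : nat) (w : 'cV[R]_n) : R :=
  \sum_(i < n) w i 0 ^+ 2.

Lemma sqn_ge0 (R : realType) (n : nat) (w : 'cV[R]_n) : 0 <= sqn w.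
Proof. by apply: sumr_ge0 => i _; exact: sqr_ge0. Qed.

Lemma sqn_eq0 (R : realType) (n : nat) (w : 'cV[R]_n) : (sqn w == 0) = (w == 0).
Proof.
apply/eqP/eqP => [/eqP|->]; last first.
  by apply: big1 => i _; rewrite mxE expr0n.
rewrite psumr_eq0 => [/allP h|i _]; last exact: sqr_ge0.
apply/colP => i; have := h i (mem_index_enum _).
by rewrite sqrf_eq0 mxE => /eqP.
Qed.

Lemma sqn_col_mx (R : realType) (n p : nat) (a : 'cV[R]_n) (b : 'cV[R]_p) :
  sqn (col_mx a b) = sqn a + sqn b.
Proof.
rewrite /sqn big_split_ord /=; congr (_ + _); apply: eq_bigr => i _.
  by rewrite col_mxEu.
by rewrite col_mxEd.
Qed.

(** The quadratic form of [P (x) Pi + Q (x) (I - Pi)], written coordinate by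
    coordinate so that each summand is a point at which an LMI can be
    evaluated. *)
Definition lyapunov (R : realType) (n : nat) (P Q : 'M[R]_2)
    (e1 e2 : 'cV[R]_n) : R :=
  \sum_(i < n) (qform P (mean e1) (mean e2)
                + qform Q (e1 i 0 - mean e1) (e2 i 0 - mean e2)).

Lemma lyapunov_ge0 (R : realType) (n : nat) (P Q : 'M[R]_2)
    (e1 e2 : 'cV[R]_n) :
  posdefmx P -> posdefmx Q -> 0 <= lyapunov P Q e1 e2.
Proof.
by move=> Ppd Qpd; apply: sumr_ge0 => i _; rewrite addr_ge0 ?qform_ge0.
Qed.

(** The mean of [v] vanishes, hence means evolve by the consensus model and the
    first LMI applies to them; deviations evolve coordinatewise by the
    disagreement model and the second LMI applies to each. In the sum of all
    these inequalities the two sector multipliers merge into the full sector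
    form by [sum_qform_split], and the last multiplier is nonnegative because
    [I - Pi - Lap] has gain at most [sigma]. *)
Lemma lyapunov_dissipation (R : realType) (n : nat) (Lap : 'M[R]_n)
    (alpha zeta delta eta sigma rho m L lambda0 lambda1 : R) (P Q : 'M[R]_2)
    (e1 e2 u : 'cV[R]_n) :
  let v := Lap *m (delta *: e1 + eta *: e2) in
  (0 < n)%N -> ones^T *m Lap = 0 -> Lap *m ones = 0 ->
  0 <= lambda0 -> 0 <= lambda1 ->
  negsemidefmx (lmi_p alpha rho m L lambda0 P) ->
  negsemidefmx (lmi_q alpha zeta delta eta sigma rho m L lambda0 lambda1 Q) ->
  (forall y : 'cV[R]_n, sqn ((1%:M - avg - Lap) *m y) <= sigma ^+ 2 * sqn y) ->
  0 <= \sum_(i < n) qform (M0 m L) ((e1 - v) i 0) (u i 0) ->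
  lyapunov P Q (e1 - alpha *: u - zeta *: v) ((1%:M - avg) *m (e1 + e2 - v))
    <= rho ^+ 2 * lyapunov P Q e1 e2.
Proof.
move=> v n0 Lap1 Lap2 l0 l1 lmiP lmiQ Hsig Hsec.
have mv : mean v = 0 by exact: mean_balanced.
pose yd : 'cV[R]_n := (1%:M - avg) *m (delta *: e1 + eta *: e2).
have ydE i : yd i 0 = delta * (e1 i 0 - mean e1) + eta * (e2 i 0 - mean e2).
  by rewrite /yd dev_mul_cV meanD !meanZ !mxE; ring.
have Lyd : Lap *m yd = v.
  rewrite /yd mulmxBl mul1mx mulmxBr -/v mulmxA /avg -scalemxAr mulmxA Lap2.
  by rewrite mul0mx scaler0 mul0mx subr0.
have HM1 : 0 <= \sum_(i < n) qform (M1 sigma) (yd i 0) (v i 0).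
  under eq_bigr do rewrite qform_M1E.
  rewrite sumrB -mulr_sumr subr_ge0; apply: le_trans (Hsig yd).
  rewrite le_eqVlt; apply/orP; left; apply/eqP; apply: eq_bigr => i _.
  congr (_ ^+ 2); rewrite mulmxBl Lyd [RHS]mxE; congr (_ + _).
    by rewrite (dev_mul_cV yd) (mean_dev _ n0) subr0.
  by rewrite [RHS]mxE.
set e1' := e1 - _ - _; set e2' := _ *m _.
have me1' : mean e1' = mean e1 - alpha * mean u.
  by rewrite /e1' !meanB !meanZ mv mulr0 subr0.
have me2' : mean e2' = 0 by rewrite mean_dev.
have mx' : mean (e1 - v) = mean e1 by rewrite meanB mv subr0.
rewrite sum_qform_split // mx' in Hsec.
rewrite -subr_le0 /lyapunov mulr_sumr -sumrB.
(* The left-hand side of the goal plus the two nonnegative multipliers. *)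
have H : \sum_(i < n) (qform P (mean e1') (mean e2')
    + qform Q (e1' i 0 - mean e1') (e2' i 0 - mean e2')
    - rho ^+ 2 * (qform P (mean e1) (mean e2)
                  + qform Q (e1 i 0 - mean e1) (e2 i 0 - mean e2))
    + lambda0 * (qform (M0 m L) (mean e1) (mean u)
                 + qform (M0 m L) ((e1 - v) i 0 - mean e1) (u i 0 - mean u))
    + lambda1 * qform (M1 sigma) (yd i 0) (v i 0)) <= 0.
  apply: sumr_le0 => i _.
  have hP := lmi_p_scalar lmiP (mean e1) (mean e2) (mean u).
  have hQ := lmi_q_scalar lmiQ (e1 i 0 - mean e1) (e2 i 0 - mean e2)
               (u i 0 - mean u) (v i 0).
  rewrite -ydE in hQ; rewrite me1' me2'.
  have -> : e1' i 0 - (mean e1 - alpha * mean u) =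
     e1 i 0 - mean e1 - alpha * (u i 0 - mean u) - zeta * v i 0.
    by rewrite /e1' !mxE; ring.
  have -> : e2' i 0 - 0 = e1 i 0 - mean e1 + (e2 i 0 - mean e2) - v i 0.
    by rewrite /e2' dev_mul_cV meanB meanD mv !mxE; ring.
  have -> : (e1 - v) i 0 - mean e1 = e1 i 0 - mean e1 - v i 0.
    by rewrite !mxE; ring.
  lra.
move: H; rewrite big_split /= big_split /= -!mulr_sumr => H.
apply: le_trans H; rewrite -addrA lerDl addr_ge0 // mulr_ge0 //.
Qed.

(** * The spectrum of T *)

(** With [p] the larger root of the characteristic polynomial,
    [p * (a^2 + b^2) - qform A a b] is a quadratic form with nonnegative
    diagonal and zero determinant, hence nonnegative. *)
Lemma sym2_top_eigenvalue (R : realType) (A : 'M[R]_2) :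
  A^T = A ->
  exists2 p, eigenvalue A p & forall a b, qform A a b <= p * (a ^+ 2 + b ^+ 2).
Proof.
move=> symA; have A10 : A 1 0 = A 0 1 by rewrite -{1}symA mxE.
pose s := Num.sqrt ((A 0 0 - A 1 1) ^+ 2 + 4 * A 0 1 ^+ 2).
pose p := (A 0 0 + A 1 1 + s) / 2.
have ss : s ^+ 2 = (A 0 0 - A 1 1) ^+ 2 + 4 * A 0 1 ^+ 2.
  by rewrite sqr_sqrtr // addr_ge0 ?sqr_ge0 // mulr_ge0 ?sqr_ge0.
have charp : (p - A 0 0) * (p - A 1 1) = A 0 1 ^+ 2.
  have -> : (p - A 0 0) * (p - A 1 1) = (s ^+ 2 - (A 0 0 - A 1 1) ^+ 2) / 4.
    by rewrite /p; field.
  by rewrite ss; field.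
have s0 : 0 <= s by exact: sqrtr_ge0.
have ds : `|A 0 0 - A 1 1| <= s.
  rewrite -(ler_pXn2r (_ : 0 < 2)%N) ?nnegrE // ss real_normK ?num_real //.
  by rewrite lerDl mulr_ge0 ?sqr_ge0.
have [pa pd] : 0 <= p - A 0 0 /\ 0 <= p - A 1 1.
  move: ds; rewrite ler_norml => /andP[d1 d2].
  by split; rewrite /p; lra.
exists p.
  have rowE (x y : R) : x * (p - A 0 0) = A 0 1 * y ->
     y * (p - A 1 1) = A 0 1 * x -> (col2 x y)^T *m A = p *: (col2 x y)^T.
    move=> h1 h2; have := (col2E0 x y, col2E1 x y).
    move: (col2 x y) => w [e0 e1]; apply/rowP => j.
    rewrite !mxE sum_ord2 !mxE e0 e1; case: (unliftP 0 j) => [k ->|->].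
      rewrite ord1 (_ : lift 0 0 = 1); last exact: val_inj.
      by rewrite e1; lra.
    by rewrite e0 A10; lra.
  have trN0 (x y : R) : (x != 0) || (y != 0) -> (col2 x y)^T != 0.
    by move=> h; rewrite trmx_eq0 col2_eq0 negb_and.
  apply/eigenvalueP.
  have [h|] := boolP ((A 0 1 != 0) || (p - A 0 0 != 0)).
    exists (col2 (A 0 1) (p - A 0 0))^T; last exact: trN0.
    by apply: rowE => //; rewrite charp expr2.
  rewrite negb_or !negbK => /andP[/eqP b0 /eqP a0].
  exists (col2 1 0)^T; last by rewrite trN0 ?oner_eq0.
  by apply: rowE; rewrite ?a0 ?b0; ring.
move=> a b; rewrite qformE A10 -subr_ge0.
set A00 := A 0 0 in pa charp *; set A11 := A 1 1 in pd charp *.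
set A01 := A 0 1 in charp *.
have [pa0|pa0] := eqVneq (p - A00) 0.
  have : A01 ^+ 2 = 0 by rewrite -charp pa0 mul0r.
  move/eqP; rewrite sqrf_eq0 => /eqP b0; rewrite b0.
  have := mulr_ge0 pd (sqr_ge0 b); nra.
have pa1 : 0 < p - A00 by rewrite lt_neqAle eq_sym pa0.
(* Multiplying by the leading coefficient completes the square. *)
rewrite -(pmulr_rge0 _ pa1).
have -> : (p - A00) * (p * (a ^+ 2 + b ^+ 2) -
   (A00 * a ^+ 2 + (A01 + A01) * (a * b) + A11 * b ^+ 2))
  = ((p - A00) * a - A01 * b) ^+ 2
    + ((p - A00) * (p - A11) - A01 ^+ 2) * b ^+ 2.
  by ring.
by rewrite charp subrr mul0r addr0 sqr_ge0.
Qed.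

Lemma avgE (R : realType) (n : nat) i j : (avg : 'M[R]_n) i j = n%:R^-1.
Proof. by rewrite /avg !mxE big_ord1 !mxE !mulr1. Qed.

Lemma ones_avg (R : realType) (n : nat) :
  (0 < n)%N -> ones^T *m avg = ones^T :> 'rV[R]_n.
Proof.
move=> n0; apply/rowP => j; rewrite !mxE -[RHS](mean_ones (R := R) 1 n0) /mean.
rewrite mulr_sumr; apply: eq_bigr => i _.
by rewrite avgE !mxE mulr1 mul1r mulr1.
Qed.

Lemma avg_idem (R : realType) (n : nat) :
  (0 < n)%N -> avg *m avg = avg :> 'M[R]_n.
Proof.
by move=> n0; rewrite {1}/avg -scalemxAl -mulmxA ones_avg.
Qed.

Lemma tensZl (R : realType) (m n p q : nat) c (A : 'M[R]_(m, n))
    (B : 'M[R]_(p, q)) : tensmx (c *: A) B = c *: tensmx A B.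
Proof. by apply/matrixP => i j; rewrite !mxE mulrA. Qed.

Lemma tens_neq0 (R : realType) (m n p q : nat) (A : 'M[R]_(m, n))
    (B : 'M[R]_(p, q)) : A != 0 -> B != 0 -> tensmx A B != 0.
Proof.
case/matrix0Pn => i [j Aij] /matrix0Pn[k [l Bkl]]; apply/matrix0Pn.
exists (mxtens_index (i, k)), (mxtens_index (j, l)).
by rewrite tensmxE mulf_neq0.
Qed.

Lemma eigenvalueN (R : realType) (n : nat) (A : 'M[R]_n) a :
  eigenvalue (- A) a -> eigenvalue A (- a).
Proof.
case/eigenvalueP => v vA v0; apply/eigenvalueP; exists v => //.
by rewrite scaleNr -vA mulmxN opprK.
Qed.

Section TensorSpectrum.
Variables (R : realType) (n : nat).
Implicit Types P Q : 'M[R]_2.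

Let Tmx P Q : 'M[R]_(2 * n) := tensmx P avg + tensmx Q (1%:M - avg).

(** On [r (x) 1^T] the second summand vanishes and the first acts as [P]. *)
Lemma eigenvalue_tens_avg P Q a :
  (0 < n)%N -> eigenvalue P a -> eigenvalue (Tmx P Q) a.
Proof.
move=> n0 /eigenvalueP[r rP r0]; apply/eigenvalueP.
exists (tensmx r (ones^T : 'rV[R]_n)); last first.
  suff s0 : (ones^T : 'rV[R]_n) != 0 by exact: (tens_neq0 r0 s0).
  by apply/matrix0Pn; exists 0, (Ordinal n0); rewrite !mxE oner_eq0.
apply: etrans (mulmxDr (tensmx r (ones^T : 'rV[R]_n)) _ _) _.
rewrite !tensmx_mul rP mulmxBr mulmx1 ones_avg // subrr tensmx0 addr0.
exact: tensZl.
Qed.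

(** Any row of [I - Pi] is killed by [Pi], so tensoring it with an eigenvector
    of [Q] leaves only the second summand; a nonzero row exists as soon as there
    are two agents. *)
Lemma eigenvalue_tens_dev P Q a :
  (0 < n)%N -> 1%:M - avg != 0 :> 'M[R]_n -> eigenvalue Q a ->
  eigenvalue (Tmx P Q) a.
Proof.
move=> n0 /matrix0Pn[i [j Dij]] /eigenvalueP[r rQ r0]; apply/eigenvalueP.
pose s : 'rV[R]_n := row i (1%:M - avg).
have sPi : s *m avg = 0.
  by rewrite /s -row_mul mulmxBl mul1mx avg_idem // subrr row0.
exists (tensmx r s); last first.
  suff s0 : s != 0 by exact: (tens_neq0 r0 s0).
  by apply/matrix0Pn; exists 0, j; rewrite mxE.
apply: etrans (mulmxDr (tensmx r s) _ _) _.
rewrite !tensmx_mul rQ mulmxBr mulmx1 sPi subr0 tensmx0 add0r.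
exact: tensZl.
Qed.

Lemma sqn_split (e1 e2 : 'cV[R]_n) : (0 < n)%N ->
  sqn e1 + sqn e2
  = \sum_(i < n) (mean e1 ^+ 2 + mean e2 ^+ 2
                 + ((e1 i 0 - mean e1) ^+ 2 + (e2 i 0 - mean e2) ^+ 2)).
Proof.
move=> n0; have q1 a b : qform (1%:M : 'M[R]_2) a b = a ^+ 2 + b ^+ 2.
  by rewrite qformE !mxE /=; ring.
have := sum_qform_split 1%:M e1 e2 n0.
under eq_bigr do rewrite q1; rewrite big_split => ->.
by apply: eq_bigr => i _; rewrite !q1.
Qed.

(** The larger of the top eigenvalues of [P] and [Q] dominates both parts of the
    Lyapunov function and is itself an eigenvalue; if [I = Pi] there are no
    deviations and [P] alone decides. *)
Lemma tens_top_eigenvalue P Q : (0 < n)%N -> P^T = P -> Q^T = Q ->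
  exists c, [/\ eigenvalue (Tmx P Q) c, eigenvalue P c \/ eigenvalue Q c &
    forall e1 e2 : 'cV[R]_n, lyapunov P Q e1 e2 <= c * (sqn e1 + sqn e2)].
Proof.
move=> n0 /sym2_top_eigenvalue[p eP topP] /sym2_top_eigenvalue[q eQ topQ].
have [D0|D0] := eqVneq (1%:M - avg : 'M[R]_n) 0.
  exists p; split; [exact: eigenvalue_tens_avg|by left|move=> e1 e2].
  rewrite sqn_split // mulr_sumr; apply: ler_sum => i _.
  have d0 (w : 'cV[R]_n) : w i 0 - mean w = 0.
    by rewrite -dev_mul_cV D0 mul0mx mxE.
  by rewrite !d0; have := topP (mean e1) (mean e2); rewrite (qformE Q); lra.
have bnd c (e1 e2 : 'cV[R]_n) : p <= c -> q <= c ->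
    lyapunov P Q e1 e2 <= c * (sqn e1 + sqn e2).
  move=> pc qc; rewrite sqn_split // mulr_sumr; apply: ler_sum => i _.
  rewrite mulrDr lerD //.
    by apply: le_trans (topP _ _) _; rewrite ler_wpM2r // addr_ge0 ?sqr_ge0.
  by apply: le_trans (topQ _ _) _; rewrite ler_wpM2r // addr_ge0 ?sqr_ge0.
have [pq|/ltW qp] := leP p q.
- exists q; split; [exact: eigenvalue_tens_dev|by right|].
  by move=> e1 e2; exact: bnd.
- exists p; split; [exact: eigenvalue_tens_avg|by left|].
  by move=> e1 e2; exact: bnd.
Qed.

(** The top eigenvalue statement for [- P] and [- Q]. *)
Lemma tens_bottom_eigenvalue P Q : (0 < n)%N -> P^T = P -> Q^T = Q ->
  exists c, [/\ eigenvalue (Tmx P Q) c, eigenvalue P c \/ eigenvalue Q c &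
    forall e1 e2 : 'cV[R]_n, c * (sqn e1 + sqn e2) <= lyapunov P Q e1 e2].
Proof.
move=> n0 sP sQ.
have sN (A : 'M[R]_2) : A^T = A -> (- A)^T = - A.
  by move=> e; rewrite raddfN /= e.
have [c [eT ePQ bnd]] := tens_top_eigenvalue n0 (sN P sP) (sN Q sQ).
exists (- c); split.
- apply: eigenvalueN; rewrite (_ : - Tmx P Q = Tmx (- P) (- Q)) //.
  by apply/matrixP => i j; rewrite !mxE; ring.
- by case: ePQ => /eigenvalueN; [left|right].
- move=> e1 e2; rewrite mulNr lerNl; apply: le_trans (bnd e1 e2).
  rewrite /lyapunov -sumrN le_eqVlt; apply/orP; left; apply/eqP.
  by apply: eq_bigr => i _; rewrite !qformE !mxE; ring.
Qed.

Definition tens_block (v : 'rV[R]_(2 * n)) (a : 'I_2) : 'cV[R]_n :=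
  \col_i v 0 (mxtens_index (a, i)).

(** Reading an eigenvector of the Kronecker sum as a pair of columns, the
    eigenvector equation splits into one equation for the means and one for the
    deviations; pairing each with its own vector gives the Rayleigh quotient
    without cross terms. *)
Lemma tens_eigenvalue_rayleigh P Q c : (0 < n)%N -> eigenvalue (Tmx P Q) c ->
  exists e1 e2 : 'cV[R]_n, 0 < sqn e1 + sqn e2 /\
    lyapunov P Q e1 e2 = c * (sqn e1 + sqn e2).
Proof.
move=> n0 /eigenvalueP[v vT v0].
pose e := tens_block v.
have eE a i : e a i 0 = v 0 (mxtens_index (a, i)) by rewrite mxE.
have vE b j : c * e b j 0 = \sum_(a < 2) (P a b * mean (e a)
    + Q a b * (e a j 0 - mean (e a))).
  have := congr1 (fun w : 'rV[R]_(2 * n) => w 0 (mxtens_index (b, j))) vT.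
  rewrite /= [RHS]mxE -eE => <-; rewrite mxE.
  rewrite (reindex (@mxtens_index 2 n)) /=; last first.
    exists (@mxtens_unindex 2 n) => i _; first by rewrite mxtens_indexK.
    by rewrite mxtens_unindexK.
  transitivity (\sum_(a < 2) \sum_(i < n) v 0 (mxtens_index (a, i)) *
     Tmx P Q (mxtens_index (a, i)) (mxtens_index (b, j))).
    by rewrite pair_bigA /=; apply: eq_bigr => -[a i] _.
  apply: eq_bigr => a _.
  under eq_bigr => i _.
    rewrite /Tmx mxE !tensmxE avgE [(1%:M - avg) _ _]mxE [(- avg) _ _]mxE.
    rewrite avgE mxE.
    rewrite (_ : v 0 _ * _ = (P a b - Q a b) * (n%:R^-1 * e a i 0)
        + Q a b * (e a i 0 *+ (i == j))); last first.
      by rewrite -[e a i 0 *+ _]mulr_natr eE; ring.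
    over.
  rewrite big_split /= -!mulr_sumr -/(mean _).
  rewrite (bigD1 j) //= eqxx big1 ?addr0 => [|i /negbTE->] //.
  by rewrite mulr1n; ring.
have n0R : n%:R != 0 :> R by rewrite pnatr_eq0 -lt0n.
have mE b : c * mean (e b) = \sum_(a < 2) P a b * mean (e a).
  apply: (mulfI n0R); rewrite mulrCA -mean_sum // mulr_sumr.
  under eq_bigr do rewrite vE big_split /=.
  rewrite big_split /= sumr_const card_ord -[_ *+ n]mulr_natl.
  rewrite exchange_big /= [X in _ + X]big1 ?addr0 // => a _.
  by rewrite -mulr_sumr sum_dev // mulr0.
have dE b j : c * (e b j 0 - mean (e b))
    = \sum_(a < 2) Q a b * (e a j 0 - mean (e a)).
  by rewrite mulrBr vE mE big_split /= addrAC subrr add0r.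
exists (e 0), (e 1); split.
  rewrite lt_neqAle addr_ge0 ?sqn_ge0 // andbT eq_sym paddr_eq0 ?sqn_ge0 //.
  rewrite !sqn_eq0; apply: contra v0 => /andP[/eqP h0 /eqP h1].
  apply/eqP/rowP => k; case: (mxtens_indexP k) => a i.
  rewrite -eE.
  case: (unliftP 0 a) => [a' ->|->]; last by rewrite h0 !mxE.
  by rewrite ord1 (_ : lift 0 0 = 1) ?h1 ?mxE //; apply: val_inj.
rewrite sqn_split // mulr_sumr; apply: eq_bigr => j _; rewrite !qformE.
have := (mE 0, mE 1); rewrite !sum_ord2 => -[m0 m1].
have := (dE 0 j, dE 1 j); rewrite !sum_ord2 => -[d0 d1].
set x := mean (e 0) in m0 m1 *; set y := mean (e 1) in m0 m1 *.
set s := e 0 j 0 - x in d0 d1 *; set t := e 1 j 0 - y in d0 d1 *.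
transitivity (x * (c * x) + y * (c * y) + (s * (c * s) + t * (c * t))).
  by rewrite m0 m1 d0 d1; ring.
by ring.
Qed.

(** [lambda_min] and [lambda_max] are an infimum and a supremum of a set of
    eigenvalues: attained extreme Rayleigh quotients bound them from one side,
    and [tens_eigenvalue_rayleigh] from the other. *)
Lemma tens_rayleigh_bounds P Q : (0 < n)%N -> posdefmx P -> posdefmx Q ->
  0 < lambda_min (Tmx P Q) <= lambda_max (Tmx P Q) /\
  forall e1 e2 : 'cV[R]_n,
    lambda_min (Tmx P Q) * (sqn e1 + sqn e2) <= lyapunov P Q e1 e2
      <= lambda_max (Tmx P Q) * (sqn e1 + sqn e2).
Proof.
move=> n0 Ppd Qpd.
have [c [eTc ePQ lec]] := tens_bottom_eigenvalue n0 Ppd.1 Qpd.1.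
have [d [eTd _ led]] := tens_top_eigenvalue n0 Ppd.1 Qpd.1.
have eig_gt0 (A : 'M[R]_2) : posdefmx A -> eigenvalue A c -> 0 < c.
  case=> _ pA /eigenvalueP[r rA r0].
  have := pA r^T; rewrite trmx_eq0 r0 trmxK rA -scalemxAl mxE => /(_ isT).
  rewrite pmulr_lgt0 //.
  have := sqn_ge0 r^T; rewrite le_eqVlt eq_sym sqn_eq0 trmx_eq0 (negbTE r0) /=.
  rewrite /sqn mxE; under eq_bigr do rewrite expr2.
  by under [in X in _ -> X]eq_bigr do rewrite -{1}[r]trmxK mxE.
have c0 : 0 < c by case: ePQ; exact: eig_gt0.
have inb a : eigenvalue (Tmx P Q) a -> c <= a <= d.
  case/(tens_eigenvalue_rayleigh n0) => e1 [e2 [epos ee]].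
  have := lec e1 e2; have := led e1 e2; rewrite ee.
  by rewrite !ler_pM2r // => -> ->.
have mc : lambda_min (Tmx P Q) <= c.
  by apply: ge_inf => //; exists c => a /= /inb/andP[].
have cm : c <= lambda_min (Tmx P Q).
  by apply: lb_le_inf; [exists c|move=> a /= /inb/andP[]].
have dM : d <= lambda_max (Tmx P Q).
  by apply: ub_le_sup => //; exists d => a /= /inb/andP[].
have /andP[_ cd] := inb c eTc.
split; first by rewrite (lt_le_trans c0 cm) (le_trans mc) // (le_trans cd).
move=> e1 e2; have s0 : 0 <= sqn e1 + sqn e2 by rewrite addr_ge0 ?sqn_ge0.
by rewrite (le_trans (ler_wpM2r s0 mc)) // (le_trans (led _ _)) // ler_wpM2r.
Qed.

End TensorSpectrum.

(** * Euclidean and spectral norms, the Laplacian, stationarity *)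

Lemma enormE (R : realType) (n : nat) (w : 'cV[R]_n) :
  enorm w = Num.sqrt (sqn w).
Proof. by []. Qed.

Lemma enorm_ge0 (R : realType) (n : nat) (w : 'cV[R]_n) : 0 <= enorm w.
Proof. exact: sqrtr_ge0. Qed.

Lemma enorm0 (R : realType) (n : nat) : enorm (0 : 'cV[R]_n) = 0.
Proof. by rewrite /enorm big1 ?sqrtr0 // => i _; rewrite mxE expr0n. Qed.

Lemma enorm_sqr (R : realType) (n : nat) (w : 'cV[R]_n) : enorm w ^+ 2 = sqn w.
Proof. by rewrite sqr_sqrtr // sqn_ge0. Qed.

Lemma enormZ (R : realType) (n : nat) c (w : 'cV[R]_n) :
  enorm (c *: w) = `|c| * enorm w.
Proof.
rewrite !enormE -sqrtr_sqr -sqrtrM ?sqr_ge0 //; congr Num.sqrt.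
by rewrite /sqn mulr_sumr; apply: eq_bigr => i _; rewrite mxE exprMn.
Qed.

(** Needed to make the supremum defining [spectral_norm] meaningful; on the unit
    ball each coordinate is at most 1, which gives absolute row sums. *)
Lemma enorm_mul_bounded (R : realType) (p n : nat) (A : 'M[R]_(p, n)) :
  has_ubound [set enorm (A *m x) | x in [set x : 'cV[R]_n | enorm x <= 1]].
Proof.
exists (Num.sqrt (\sum_(i < p) (\sum_(j < n) `|A i j|) ^+ 2)) => _ [x /= x1 <-].
rewrite ler_wsqrtr // ler_sum // => i _.
have xj j : `|x j 0| <= 1.
  rewrite -(ler_pXn2r (_ : 0 < 2)%N) ?nnegrE // expr1n real_normK ?num_real //.
  have : sqn x <= 1 by rewrite -enorm_sqr exprn_ile1 ?enorm_ge0.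
  apply: le_trans; rewrite /sqn (bigD1 j) //= lerDl.
  by apply: sumr_ge0 => k _; exact: sqr_ge0.
rewrite -real_normK ?num_real // ler_pXn2r ?nnegrE ?sumr_ge0 // mxE.
apply: le_trans (ler_norm_sum _ _ _) _; apply: ler_sum => j _.
by rewrite normrM ler_piMr.
Qed.

Lemma enorm_mul_le (R : realType) (p n : nat) (A : 'M[R]_(p, n))
    (y : 'cV[R]_n) :
  enorm (A *m y) <= spectral_norm A * enorm y.
Proof.
have [y0|y0] := eqVneq (enorm y) 0.
  have : sqn y = 0 by rewrite -enorm_sqr y0 expr0n.
  move/eqP; rewrite sqn_eq0 => /eqP->.
  by rewrite mulmx0 !enorm0 mulr0.
have yp : 0 < enorm y by rewrite lt_neqAle eq_sym y0 enorm_ge0.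
rewrite -ler_pdivrMr //; apply: ub_le_sup; first exact: enorm_mul_bounded.
exists ((enorm y)^-1 *: y) => /=.
  by rewrite enormZ ger0_norm ?invr_ge0 ?enorm_ge0 // mulVf.
by rewrite -scalemxAr enormZ ger0_norm ?invr_ge0 ?enorm_ge0 // mulrC.
Qed.

Lemma spectral_norm_ge0 (R : realType) (p n : nat) (A : 'M[R]_(p, n)) :
  0 <= spectral_norm A.
Proof.
apply: (@le_trans _ _ (enorm (A *m 0))); first exact: enorm_ge0.
apply: ub_le_sup; first exact: enorm_mul_bounded.
by exists 0 => //=; rewrite enorm0.
Qed.

Lemma sqn_mul_le (R : realType) (p n : nat) (A : 'M[R]_(p, n)) (y : 'cV[R]_n) :
  sqn (A *m y) <= spectral_norm A ^+ 2 * sqn y.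
Proof.
rewrite -!enorm_sqr -exprMn ler_pXn2r ?nnegrE ?mulr_ge0 ?enorm_ge0 //.
  exact: enorm_mul_le.
exact: spectral_norm_ge0.
Qed.

Lemma laplacian_ones (R : realType) (n : nat) (G : wdigraph R n) :
  laplacian G *m ones = 0 :> 'cV[R]_n.
Proof.
apply/colP => i; rewrite !mxE (bigD1 i) //= !mxE eqxx mulr1.
apply/eqP; rewrite addr_eq0; apply/eqP; rewrite -sumrN; apply: eq_bigr => j ji.
by rewrite !mxE eq_sym (negbTE ji) mulr1 opprK.
Qed.

Lemma avg_mul_eq0 (R : realType) (n : nat) (y : 'cV[R]_n) :
  mean y = 0 -> avg *m y = 0.
Proof. by move=> y0; apply/colP => i; rewrite avg_mul_cV y0 mxE. Qed.

(** Since [sigma < 1], the operator [I - Pi - Lap] fixes no nonzero vector, so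
    [Lap + Pi] is injective, hence invertible; on right-hand sides of zero mean
    its inverse gives a zero-mean solution, on which [Pi] vanishes. *)
Lemma laplacian_solve (R : realType) (n : nat) (Lap : 'M[R]_n) (v : 'cV[R]_n) :
  (0 < n)%N -> ones^T *m Lap = 0 -> spectral_norm (1%:M - avg - Lap) < 1 ->
  mean v = 0 -> exists2 y : 'cV[R]_n, mean y = 0 & Lap *m y = v.
Proof.
move=> n0 Lap1 sig v0.
have mean_sol (y w : 'cV[R]_n) :
    (Lap + avg) *m y = w -> mean w = 0 -> mean y = 0.
  move=> <-; rewrite mulmxDl meanD mean_balanced // add0r.
  rewrite (_ : avg *m y = mean y *: ones) ?mean_ones //.
  by apply/colP => i; rewrite avg_mul_cV !mxE mulr1.
have inj (y : 'cV[R]_n) : (Lap + avg) *m y = 0 -> y = 0.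
  move=> e; have my : mean y = 0.
    apply: (mean_sol y 0) => //.
    by rewrite -(scale0r (0 : 'cV[R]_n)) meanZ mul0r.
  have ey : (1%:M - avg - Lap) *m y = y.
    by rewrite -addrA -opprD [avg + Lap]addrC mulmxBl e subr0 mul1mx.
  apply/eqP; rewrite -sqn_eq0 -enorm_sqr sqrf_eq0; apply/eqP.
  have := enorm_mul_le (1%:M - avg - Lap) y; rewrite ey => h.
  apply: le_anti; rewrite enorm_ge0 andbT leNgt; apply/negP => ypos.
  by move: h; rewrite -ler_pdivrMr ?divff ?gt_eqF // leNgt sig.
have unitL : Lap + avg \in unitmx.
  rewrite -unitmx_tr -row_free_unit; apply: inj_row_free => r rL.
  apply: trmx_inj; rewrite trmx0; apply: inj.
  by rewrite -[_ + _]trmxK -trmx_mul rL trmx0.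
have eqy : (Lap + avg) *m (invmx (Lap + avg) *m v) = v by rewrite mulKVmx.
have my := mean_sol _ _ eqy v0.
exists (invmx (Lap + avg) *m v) => //.
by rewrite -{2}eqy mulmxDl (avg_mul_eq0 my) addr0.
Qed.

Lemma sum_derive_at_min (R : realType) (n : nat) (f : 'I_n -> R -> R)
    (xopt : R) :
  (forall i x, derivable (f i) x 1) ->
  (forall t, \sum_(i < n) f i xopt <= \sum_(i < n) f i t) ->
  \sum_(i < n) derive1 (f i) xopt = 0.
Proof.
move=> fd fmin; pose F : R -> R := \sum_(i < n) f i.
have FE t : F t = \sum_(i < n) f i t by rewrite /F fct_sumE.
have dF t : derivable F t 1 by apply: derivable_sum.
have h : is_derive xopt 1 F 0.
  apply: (@derive1_at_min _ F (xopt - 1) (xopt + 1)) => //.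
  - lra.
  - by rewrite in_itv /=; apply/andP; split; lra.
  - by move=> t _; rewrite !FE.
have h' : is_derive xopt 1 F (\sum_(i < n) derive1 (f i) xopt).
  apply: is_derive_sum => i; rewrite derive1E; apply: DeriveDef => //.
by have [_ <-] := h'; have [_ ->] := h.
Qed.

(** * What the LMIs force on the parameters *)

(** A function that is nonpositive and vanishes at 0 has zero slope there. *)
Lemma linear_coef_eq0 (R : realType) (b c : R) :
  (forall t, b * t + c * t ^+ 2 <= 0) -> b = 0.
Proof.
move=> h; pose s := (1 + `|c|)^-1.
have s0 : 0 < s by rewrite invr_gt0 ltr_pwDl.
have s1 : s * (1 + `|c|) = 1 by rewrite mulVf // gt_eqF // ltr_pwDl.
have sc : -1 < s * c.
  have : - `|c| <= c by have := ler_norm (- c); rewrite normrN; lra.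
  nra.
have := h (s * b).
rewrite (_ : _ + _ = s * (b ^+ 2 * (1 + s * c))); last by ring.
rewrite pmulr_rle0 // pmulr_lle0; last by lra.
by move=> b2; apply/eqP; rewrite -sqrf_eq0 eq_le b2 sqr_ge0.
Qed.

Lemma eq_le0_trans (R : realType) (x y : R) : x = y -> y <= 0 -> x <= 0.
Proof. by move->. Qed.

(** If [eta = 0], the disagreement state [(0, 1)] is a rest point of the model
    with zero input, and it is not observed. There the form equals
    [(1 - rho^2) Q 1 1], so [rho = 1] and the form attains its maximum 0; its
    slope along the first state coordinate is [2 * Q 1 1], which is nonzero. *)
Lemma lmi_q_eta_neq0 (R : realType)
    (alpha zeta delta eta sigma rho m L lambda0 lambda1 : R) (Q : 'M[R]_2) :
  posdefmx Q -> 0 <= rho <= 1 ->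
  negsemidefmx (lmi_q alpha zeta delta eta sigma rho m L lambda0 lambda1 Q) ->
  eta != 0.
Proof.
move=> Qpd /andP[r0 r1] /lmi_q_scalar H; apply/eqP => eta0.
have Q11 : 0 < Q 1 1.
  have : 0 < qform Q 0 1 by rewrite qform_gt0 // oner_eq0 orbT.
  by rewrite qformE; lra.
have rho1 : rho ^+ 2 = 1.
  have h : Q 1 1 * (1 - rho ^+ 2) <= 0.
    apply: eq_le0_trans (H 0 1 0 0).
    by rewrite qform_M0E qform_M1E !qformE eta0; ring.
  by apply: le_anti; rewrite exprn_ile1 //= -subr_le0 -(pmulr_rle0 _ Q11).
suff : 2 * Q 1 1 = 0 by lra.
apply: (@linear_coef_eq0 _ _ (Q 1 1 + (Q 0 1 + Q 1 0) - 2 * m * L * lambda0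
   + lambda1 * (sigma ^+ 2 - 1) * delta ^+ 2)) => t.
apply: eq_le0_trans (H t 1 0 0).
by rewrite qform_M0E qform_M1E !qformE eta0 rho1; ring.
Qed.

(** If [zeta = 0], the state [(1, b)] with inputs [u = 0], [v = 1] is at rest
    whatever [b] is; choosing [b] so that the transmitted signal is also 1 makes
    all multiplier terms nonnegative. Hence [rho = 1] and the form is maximal
    there; vanishing slopes in [u] (where [alpha] enters as a factor) and in
    [v] say that [Q (1, b) = 0], against positive definiteness. *)
Lemma lmi_q_zeta_neq0 (R : realType)
    (alpha zeta delta eta sigma rho m L lambda0 lambda1 : R) (Q : 'M[R]_2) :
  posdefmx Q -> 0 <= rho <= 1 -> 0 <= lambda1 -> alpha != 0 ->
  negsemidefmx (lmi_q alpha zeta delta eta sigma rho m L lambda0 lambda1 Q) ->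
  zeta != 0.
Proof.
move=> Qpd rho01 l1 alpha0 lmiQ.
have eta0 := lmi_q_eta_neq0 Qpd rho01 lmiQ.
move: lmiQ rho01 => /lmi_q_scalar H /andP[r0 r1]; apply/eqP => zeta0.
pose b := (1 - delta) / eta.
have yb : delta * 1 + eta * b = 1.
  by rewrite /b mulr1 mulrC divfK // addrC subrK.
have Qb : 0 < qform Q 1 b by rewrite qform_gt0 // oner_eq0.
have [rho1 ls] : rho ^+ 2 = 1 /\ lambda1 * sigma ^+ 2 = 0.
  have : qform Q 1 b * (1 - rho ^+ 2) + lambda1 * sigma ^+ 2 <= 0.
    apply: eq_le0_trans (H 1 b 0 1).
    by rewrite yb qform_M0E qform_M1E !qformE zeta0; ring.
  have h1 : 0 <= qform Q 1 b * (1 - rho ^+ 2).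
    by rewrite mulr_ge0 ?(ltW Qb) // subr_ge0 exprn_ile1.
  have h2 : 0 <= lambda1 * sigma ^+ 2 by rewrite mulr_ge0 ?sqr_ge0.
  move=> h3; split; last by lra.
  have /eqP : qform Q 1 b * (1 - rho ^+ 2) = 0 by lra.
  by rewrite mulf_eq0 gt_eqF //= subr_eq0 eq_sym => /eqP.
have gu : - alpha * (2 * Q 0 0 + (Q 0 1 + Q 1 0) * b) = 0.
  apply: (@linear_coef_eq0 _ _ (alpha ^+ 2 * Q 0 0 - 2 * lambda0)) => t.
  apply: eq_le0_trans (H 1 b t 1).
  by rewrite yb qform_M0E qform_M1E !qformE zeta0 rho1; ring: ls.
have gv : (Q 0 1 + Q 1 0) + 2 * Q 1 1 * b = 0.
  apply: (@linear_coef_eq0 _ _ (Q 1 1 - 2 * m * L * lambda0 - lambda1)) => t.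
  apply: eq_le0_trans (H 1 b 0 (1 - t)).
  by rewrite yb qform_M0E qform_M1E !qformE zeta0 rho1; ring: ls.
have /eqP := gu; rewrite mulf_eq0 oppr_eq0 (negbTE alpha0) /= => /eqP gu'.
have : 2 * qform Q 1 b = 0.
  rewrite qformE (_ : 2 * _ = (2 * Q 0 0 + (Q 0 1 + Q 1 0) * b)
    + b * (Q 0 1 + Q 1 0 + 2 * Q 1 1 * b)); last by ring.
  by rewrite gu' gv mulr0 addr0.
lra.
Qed.

(** Triangle inequality for the norm [sqrt V], on bounds: the value at
    [t a - s b] is nonnegative, which bounds the cross term between [a] and [b]
    by [s t]. *)
Lemma lyapunov_add (R : realType) (n : nat) (P Q : 'M[R]_2)
    (a1 a2 b1 b2 : 'cV[R]_n) (s t : R) :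
  posdefmx P -> posdefmx Q -> 0 < s -> 0 < t ->
  lyapunov P Q a1 a2 <= s ^+ 2 -> lyapunov P Q b1 b2 <= t ^+ 2 ->
  lyapunov P Q (a1 + b1) (a2 + b2) <= (s + t) ^+ 2.
Proof.
move=> Ppd Qpd s0 t0 ha hb.
have key : s * t * lyapunov P Q (a1 + b1) (a2 + b2)
    + lyapunov P Q (t *: a1 - s *: b1) (t *: a2 - s *: b2)
  = (s + t) * (t * lyapunov P Q a1 a2 + s * lyapunov P Q b1 b2).
  rewrite /lyapunov !mulr_sumr -!big_split mulr_sumr /=; apply: eq_bigr => i _.
  by rewrite !meanB !meanD !meanZ !mxE !qformE; ring.
have h0 := lyapunov_ge0 (t *: a1 - s *: b1) (t *: a2 - s *: b2) Ppd Qpd.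
rewrite -(ler_pM2l (mulr_gt0 s0 t0)).
have h1 : (s + t) * (t * lyapunov P Q a1 a2 + s * lyapunov P Q b1 b2)
    <= (s + t) * (t * s ^+ 2 + s * t ^+ 2).
  apply: ler_wpM2l; first by rewrite addr_ge0 // ltW.
  by apply: lerD; apply: ler_wpM2l => //; exact: ltW.
rewrite (_ : s * t * (s + t) ^+ 2 = (s + t) * (t * s ^+ 2 + s * t ^+ 2));
  last by ring.
by apply: le_trans h1; rewrite -key lerDl.
Qed.

Lemma qform_M0_slope (R : realType) (m L x : R) : qform (M0 m L) x (m * x) = 0.
Proof. by rewrite qform_M0E; ring. Qed.

Lemma sector_qform (R : realType) (m L xopt : R) (f : R -> R) x :
  sector_bounded m L xopt f ->
  0 <= qform (M0 m L) (x - xopt) (derive1 f x - derive1 f xopt).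
Proof. by move=> h; exact: h. Qed.

(** The sector condition makes every local gradient increment have the sign of
    [c - xopt], with at least linear size. *)
Lemma stationary_point_unique (R : realType) (n : nat) (f : 'I_n -> R -> R)
    (m L xopt c : R) :
  (0 < n)%N -> 0 < m -> m <= L -> (forall i, sector_bounded m L xopt (f i)) ->
  \sum_(i < n) derive1 (f i) xopt = 0 -> \sum_(i < n) derive1 (f i) c = 0 ->
  c = xopt.
Proof.
move=> n0 m0 mL sec so sc.
pose g i := derive1 (f i) c - derive1 (f i) xopt.
have gi i : m * L * (c - xopt) ^+ 2 <= (L + m) * (c - xopt) * g i.
  have := sector_qform c (sec i); rewrite qform_M0E -/(g i).
  have := sqr_ge0 (g i); lra.
have sg : \sum_(i < n) g i = 0 by rewrite sumrB so sc subrr.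
have : \sum_(i < n) m * L * (c - xopt) ^+ 2 <= 0.
  apply: le_trans (ler_sum _ (fun i _ => gi i)) _.
  by rewrite -mulr_sumr sg mulr0.
rewrite sumr_const card_ord pmulrn_lle0 // pmulr_rle0; last first.
  by rewrite mulr_gt0 // (lt_le_trans m0).
by move=> h; apply/eqP; rewrite -subr_eq0 -sqrf_eq0 eq_le h sqr_ge0.
Qed.

(** * Fixed points and convergence *)

Section Trajectories.
Variables (R : realType) (n : nat) (f : 'I_n -> R -> R) (Lap : 'M[R]_n).
Variables (alpha zeta delta eta rho m L lambda0 lambda1 xopt : R).
Variables (P Q : 'M[R]_2).

Let sigma := spectral_norm (1%:M - avg - Lap).

Hypothesis n_gt0 : (0 < n)%N.
Hypothesis Lap_balanced : ones^T *m Lap = 0.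
Hypothesis Lap_ones : Lap *m ones = 0.
Hypothesis sigma_lt1 : sigma < 1.
Hypothesis m_gt0 : 0 < m.
Hypothesis m_le_L : m <= L.
Hypothesis f_sector : forall i, sector_bounded m L xopt (f i).
Hypothesis xopt_stationary : \sum_(i < n) derive1 (f i) xopt = 0.
Hypothesis rho_ge0 : 0 <= rho.
Hypothesis lambda0_ge0 : 0 <= lambda0.
Hypothesis lambda1_ge0 : 0 <= lambda1.
Hypothesis P_pd : posdefmx P.
Hypothesis Q_pd : posdefmx Q.
Hypothesis lmiP : negsemidefmx (lmi_p alpha rho m L lambda0 P).
Hypothesis lmiQ :
  negsemidefmx (lmi_q alpha zeta delta eta sigma rho m L lambda0 lambda1 Q).

Let V := @lyapunov R n P Q.
Let xstar : 'cV[R]_n := xopt *: ones.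

Lemma mean_grad_xstar : mean (grad f xstar) = 0.
Proof.
rewrite /mean (_ : \sum_i _ = 0) ?mulr0 // -[RHS]xopt_stationary.
by apply: eq_bigr => i _; rewrite !mxE mulr1.
Qed.

Lemma Lap_consensus c : Lap *m (c *: ones) = 0.
Proof. by rewrite -scalemxAr Lap_ones scaler0. Qed.

Lemma dev_consensus c : (1%:M - avg) *m (c *: ones) = 0 :> 'cV[R]_n.
Proof.
by apply/colP => i; rewrite dev_mul_cV mean_ones // !mxE mulr1 subrr.
Qed.

Lemma dev_id (w : 'cV[R]_n) : mean w = 0 -> (1%:M - avg) *m w = w.
Proof. by move=> w0; rewrite mulmxBl mul1mx avg_mul_eq0 // subr0. Qed.

(** If [alpha = 0] the consensus state at the optimizer with [w2 = 0] is at
    rest. Otherwise rest requires [alpha u + zeta v = 0], which determines [v]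
    as [zeta] is nonzero; [v] has zero mean because the gradients sum to zero,
    so it is in the range of the Laplacian, and [eta] nonzero lets [w2] realize
    the preimage. *)
Lemma optimal_fixed_point : rho <= 1 ->
  exists2 s, Gm_fixed_point f Lap alpha zeta delta eta s & sig_x s = xstar.
Proof.
move=> rho_le1; have rho01 : 0 <= rho <= 1 by rewrite rho_ge0.
have [a0|a0] := eqVneq alpha 0.
  exists (Signals xstar 0 xstar (delta *: xstar) (grad f xstar) 0) => //.
  split => //=; rewrite ?subr0 ?scaler0 ?addr0 ?a0 ?scale0r ?subr0 //.
    by rewrite dev_consensus !mulmx0 !addr0 subr0.
  by split=> //; rewrite -scalemxAr Lap_consensus scaler0.
have eta0 := lmi_q_eta_neq0 Q_pd rho01 lmiQ.
have zeta0 := lmi_q_zeta_neq0 Q_pd rho01 lambda1_ge0 a0 lmiQ.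
pose u := grad f xstar; pose v := - (alpha / zeta) *: u.
have v0 : mean v = 0 by rewrite meanZ mean_grad_xstar mulr0.
have [y y0 Ly] := laplacian_solve n_gt0 Lap_balanced sigma_lt1 v0.
pose w1 := xstar + v; pose w2 := eta^-1 *: (y - delta *: v).
have w20 : mean w2 = 0 by rewrite meanZ meanB meanZ y0 v0 mulr0 subrr mulr0.
exists (Signals w1 w2 xstar (delta *: w1 + eta *: w2) u v) => //.
split => //=.
- rewrite -addrA -opprD (_ : _ + zeta *: v = 0) ?subr0 //.
  by rewrite /v scalerA mulrN mulrCA mulfV // mulr1 scaleNr subrr.
- rewrite addrAC -mulmxBr /w1 addrK dev_consensus add0r.
  by rewrite dev_id.
- by rewrite /w1 addrK.
- split => //; have -> : delta *: w1 + eta *: w2 = y + delta *: xstar.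
    by apply/colP => i; rewrite !mxE; field; rewrite eta0 zeta0.
  by rewrite mulmxDr Ly -scalemxAr Lap_consensus scaler0 addr0.
Qed.

(** The second state equation forces consensus of [x], and the mean of the first
    one forces the gradients at that consensus value to sum to zero. *)
Lemma fixed_point_optimal s :
  alpha != 0 -> Gm_fixed_point f Lap alpha zeta delta eta s -> sig_x s = xstar.
Proof.
move=> a0 [e1 e2 e3 e4 [e5 e6]].
have mv : mean (sig_v s) = 0 by rewrite e6 mean_balanced.
have xc : sig_x s = mean (sig_x s) *: ones.
  have : (1%:M - avg) *m sig_x s = 0.
    have w20 : mean (sig_w2 s) = 0.
      by rewrite e2 -mulmxDr -mulmxBr mean_dev.
    have := e2; rewrite [(1%:M - avg) *m sig_w2 s]dev_id // addrAC -mulmxBr -e3.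
    by move/eqP; rewrite eq_sym -subr_eq0 addrK => /eqP.
  move=> h; apply/colP => i; have := congr1 (fun w : 'cV[R]_n => w i 0) h.
  by rewrite /= dev_mul_cV !mxE mulr1 => /eqP; rewrite subr_eq0 => /eqP.
have mu : mean (sig_u s) = 0.
  have := congr1 (@mean R n) e1; rewrite !meanB !meanZ mv mulr0 subr0.
  move/eqP; rewrite eq_sym -subr_eq0 addrAC subrr add0r oppr_eq0 mulf_eq0.
  by rewrite (negbTE a0) /= => /eqP.
rewrite xc; congr (_ *: _).
apply: (stationary_point_unique n_gt0 m_gt0 m_le_L f_sector xopt_stationary).
have : \sum_(i < n) sig_u s i 0 = 0 by rewrite mean_sum // mu mulr0.
rewrite e5 => h; rewrite -[RHS]h.
by apply: eq_bigr => i _; rewrite [in RHS]xc !mxE mulr1.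
Qed.

Lemma sector_grad_xstar (x : 'cV[R]_n) :
  0 <= \sum_(i < n) qform (M0 m L) ((x - xstar) i 0)
                      ((grad f x - grad f xstar) i 0).
Proof.
apply: sumr_ge0 => i _; rewrite !mxE mulr1; exact: sector_qform.
Qed.

(** The sector condition is centred at the optimizer, so it applies directly
    only to fixed points located there. For [alpha = 0] other fixed points
    exist, but then the input has no effect on the state and can be replaced by
    any input in the sector, here [m (x - x_star)]. *)
Lemma fixed_point_sector s (x : 'cV[R]_n) :
  Gm_fixed_point f Lap alpha zeta delta eta s ->
  exists u : 'cV[R]_n, alpha *: u = alpha *: (grad f x - sig_u s) /\
    0 <= \sum_(i < n) qform (M0 m L) ((x - sig_x s) i 0) (u i 0).
Proof.
move=> fp; have [a0|a0] := eqVneq alpha 0.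
  exists (m *: (x - sig_x s)); split; first by rewrite a0 !scale0r.
  by apply: sumr_ge0 => i _; rewrite [X in qform _ _ X]mxE qform_M0_slope.
exists (grad f x - sig_u s); split=> //.
case: (fp) => _ _ _ _ [-> _]; rewrite (fixed_point_optimal a0 fp).
exact: sector_grad_xstar.
Qed.

Lemma fixed_point_step s0 s s' :
  Gm_fixed_point f Lap alpha zeta delta eta s0 ->
  Gm_eqs f Lap alpha zeta delta eta s s' ->
  V (sig_w1 s' - sig_w1 s0) (sig_w2 s' - sig_w2 s0)
    <= rho ^+ 2 * V (sig_w1 s - sig_w1 s0) (sig_w2 s - sig_w2 s0).
Proof.
move=> fp [h1 h2 h3 h4 [h5 h6]].
have [u [au sec]] := fixed_point_sector (sig_x s) fp.
case: fp => [k1 k2 k3 k4 [k5 k6]].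
set d1 := sig_w1 s - sig_w1 s0 in sec *; set d2 := sig_w2 s - sig_w2 s0.
have vE : Lap *m (delta *: d1 + eta *: d2) = sig_v s - sig_v s0.
  rewrite h6 k6 -mulmxBr h4 k4 /d1 /d2; congr (_ *m _).
  by apply/colP => i; rewrite !mxE; ring.
have xE : sig_x s - sig_x s0 = d1 - (sig_v s - sig_v s0).
  by rewrite h3 k3 /d1; apply/colP => i; rewrite !mxE; ring.
rewrite xE -vE in sec.
have := lyapunov_dissipation n_gt0 Lap_balanced Lap_ones lambda0_ge0
  lambda1_ge0 lmiP lmiQ (sqn_mul_le _) sec.
have -> : sig_w1 s' - sig_w1 s0
    = d1 - alpha *: u - zeta *: (sig_v s - sig_v s0).
  rewrite au h1 {1}k1 h5 /d1 /d2; apply/colP => i; rewrite !mxE; ring.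
have -> : sig_w2 s' - sig_w2 s0
    = (1%:M - avg) *m (d1 + d2 - (sig_v s - sig_v s0)).
  rewrite h2 {1}k2 -!mulmxDr -!mulmxBr; congr (_ *m _).
  by rewrite /d1 /d2; apply/colP => i; rewrite !mxE; ring.
by rewrite vE.
Qed.

Let T : 'M[R]_(2 * n) := tensmx P avg + tensmx Q (1%:M - avg).

Lemma enorm_state (s s0 : signals R n) :
  enorm (state s - state s0) =
  Num.sqrt (sqn (sig_w1 s - sig_w1 s0) + sqn (sig_w2 s - sig_w2 s0)).
Proof.
by rewrite enormE /state opp_col_mx add_col_mx sqn_col_mx.
Qed.

(** Iterating the dissipation gives [V_k <= rho^(2k) V_0]; comparing [V] with
    the squared norm at both ends costs the factor [cond(T)]. *)
Lemma Gm_linear_rate s0 s k :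
  Gm_fixed_point f Lap alpha zeta delta eta s0 ->
  Gm_trajectory f Lap alpha zeta delta eta s ->
  enorm (state (s k) - state s0) <=
    Num.sqrt (condnum T) * rho ^+ k * enorm (state (s 0%N) - state s0).
Proof.
move=> fp tr; have [/andP[lmin_gt0 lmax] bnd] :=
  tens_rayleigh_bounds n_gt0 P_pd Q_pd.
pose W j := V (sig_w1 (s j) - sig_w1 s0) (sig_w2 (s j) - sig_w2 s0).
pose N j := sqn (sig_w1 (s j) - sig_w1 s0) + sqn (sig_w2 (s j) - sig_w2 s0).
have Wk : W k <= (rho ^+ k) ^+ 2 * W 0%N.
  elim: k => [|k IH]; first by rewrite expr0 expr1n mul1r.
  apply: le_trans (fixed_point_step fp (tr k)) _.
  have -> : (rho ^+ k.+1) ^+ 2 * W 0%N = rho ^+ 2 * ((rho ^+ k) ^+ 2 * W 0%N).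
    by rewrite (exprS rho k) exprMn mulrA.
  by apply: ler_wpM2l; rewrite ?sqr_ge0.
have /andP[lo _] := bnd (sig_w1 (s k) - sig_w1 s0) (sig_w2 (s k) - sig_w2 s0).
have /andP[_ hi] :=
  bnd (sig_w1 (s 0%N) - sig_w1 s0) (sig_w2 (s 0%N) - sig_w2 s0).
have key : N k <= condnum T * (rho ^+ k) ^+ 2 * N 0%N.
  rewrite /condnum -(ler_pM2l lmin_gt0) -/T; apply: le_trans lo _.
  apply: le_trans Wk _.
  rewrite (_ : lambda_min T * _ = (rho ^+ k) ^+ 2 * (lambda_max T * N 0%N)).
    by rewrite ler_wpM2l // sqr_ge0.
  by field; rewrite gt_eqF.
have N0 : 0 <= N 0%N by rewrite addr_ge0 ?sqn_ge0.
rewrite !enorm_state -!/(N _); apply: le_trans (ler_wsqrtr key) _.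
have cond0 : 0 <= condnum T.
  by rewrite divr_ge0 // ltW // (lt_le_trans lmin_gt0).
rewrite sqrtrM; last by rewrite mulr_ge0 // sqr_ge0.
by rewrite sqrtrM // sqrtr_sqr ger0_norm // exprn_ge0.
Qed.

Definition project_signals (s : signals R n) : signals R n :=
  Signals (sig_w1 s) ((1%:M - avg) *m sig_w2 s) (sig_x s)
    (delta *: sig_w1 s + eta *: ((1%:M - avg) *m sig_w2 s)) (sig_u s) (sig_v s).

(** Replacing [w2] by its deviation changes neither [v] nor [x], because the
    Laplacian annihilates consensus vectors. *)
Lemma projected_run_trajectory s :
  alg1_run f Lap alpha zeta delta eta s ->
  Gm_trajectory f Lap alpha zeta delta eta (fun k => project_signals (s k)).
Proof.
move=> run k; have [[h1 h2] h3 h4 h5 h6] := run k.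
split => //=; first by rewrite h6 mulmxBr mulmxDr (dev_id (mean_dev _ n_gt0)).
split => //; rewrite h2 h1 !mulmxDr -!scalemxAr; congr (_ + _ *: _).
rewrite [RHS]mulmxA mulmxBr mulmx1 /avg -scalemxAr [Lap *m (_ *m _)]mulmxA.
by rewrite Lap_ones mul0mx scaler0 subr0.
Qed.

(** The gain of the output map that takes a state error [(d1, d2)] to the
    resulting error in [x]. *)
Let K := spectral_norm (row_mx (1%:M - delta *: Lap) (- (eta *: Lap))).

Lemma output_gain (d1 d2 : 'cV[R]_n) :
  enorm (d1 - Lap *m (delta *: d1 + eta *: d2))
    <= K * Num.sqrt (sqn d1 + sqn d2).
Proof.
have := enorm_mul_le (row_mx (1%:M - delta *: Lap) (- (eta *: Lap)))
  (col_mx d1 d2).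
rewrite [X in _ <= _ * X]enormE sqn_col_mx mul_row_col mulmxBl mul1mx mulNmx.
by rewrite -!scalemxAl -addrA -opprD mulmxDr -!scalemxAr.
Qed.

Lemma Gm_output_rate_le1 s : rho <= 1 ->
  Gm_trajectory f Lap alpha zeta delta eta s ->
  exists C, forall k, enorm (sig_x (s k) - xstar) <= C * rho ^+ k.
Proof.
move=> rho_le1 tr; have [s0 fp xs0] := optimal_fixed_point rho_le1.
exists (K * (Num.sqrt (condnum T) * enorm (state (s 0%N) - state s0))) => k.
have := output_gain (sig_w1 (s k) - sig_w1 s0) (sig_w2 (s k) - sig_w2 s0).
rewrite -enorm_state => h.
have rate := Gm_linear_rate k fp tr.
have K0 : 0 <= K := spectral_norm_ge0 _.
have h' := le_trans h (ler_wpM2l K0 rate).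
rewrite -[K * _ * _]mulrA [_ * enorm _ * _]mulrAC.
have [_ _ h3 h4 [_ h6]] := tr k; have [_ _ k3 k4 [_ k6]] := fp.
rewrite -xs0; apply: le_trans h'; rewrite le_eqVlt; apply/orP; left; apply/eqP.
congr enorm; rewrite h3 k3 h6 k6 h4 k4.
rewrite (_ : delta *: (_ - _) + _ = delta *: sig_w1 (s k) + eta *: sig_w2 (s k)
  - (delta *: sig_w1 s0 + eta *: sig_w2 s0)).
  by rewrite mulmxBr; apply/colP => i; rewrite !mxE; ring.
by apply/colP => i; rewrite !mxE; ring.
Qed.

(** The consensus state [(xopt 1, 0)] is always a rest point up to the constant
    term [- alpha grad F(xopt 1)] in the first equation, and its gradients are
    centred where the sector condition holds. *)
Lemma perturbed_step s s' :
  Gm_eqs f Lap alpha zeta delta eta s s' ->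
  exists a1 a2 : 'cV[R]_n,
    [/\ sig_w1 s' - xstar = a1 + (- alpha) *: grad f xstar,
        sig_w2 s' = a2 &
        V a1 a2 <= rho ^+ 2 * V (sig_w1 s - xstar) (sig_w2 s)].
Proof.
move=> [h1 h2 h3 h4 [h5 h6]].
set d1 := sig_w1 s - xstar; pose u := grad f (sig_x s) - grad f xstar.
have vE : Lap *m (delta *: d1 + eta *: sig_w2 s) = sig_v s.
  rewrite h6 h4 /d1 scalerBr addrAC mulmxBr -[Lap *m (delta *: xstar)]scalemxAr.
  by rewrite Lap_consensus scaler0 subr0.
have xE : sig_x s - xstar = d1 - sig_v s by rewrite h3 addrAC.
have := sector_grad_xstar (sig_x s); rewrite -/u xE -vE => sec.
have := lyapunov_dissipation n_gt0 Lap_balanced Lap_ones lambda0_ge0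
  lambda1_ge0 lmiP lmiQ (sqn_mul_le _) sec.
rewrite vE => step; eexists; eexists; split; last exact: step.
- by rewrite h1 h5 /u /d1; apply/colP => i; rewrite !mxE; ring.
- rewrite h2 /d1 -mulmxDr -mulmxBr.
  have -> : sig_w1 s - xstar + sig_w2 s - sig_v s
      = sig_w1 s + sig_w2 s - sig_v s - xstar.
    by apply/colP => i; rewrite !mxE; ring.
  by rewrite [RHS]mulmxBr dev_consensus subr0.
Qed.

(** For [rho > 1] a fixed point need not exist, but measured from
    [(xopt 1, 0)] the norm [sqrt V] of the error obeys
    [b_(k+1) <= rho b_k + t] with [t] bounding the constant perturbation, and
    such a sequence is still [O(rho^k)]. *)
Lemma Gm_output_rate_gt1 s : 1 < rho ->
  Gm_trajectory f Lap alpha zeta delta eta s ->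
  exists C, forall k, enorm (sig_x (s k) - xstar) <= C * rho ^+ k.
Proof.
move=> rho_gt1 tr; have [/andP[lmin_gt0 _] bnd] :=
  tens_rayleigh_bounds n_gt0 P_pd Q_pd.
(* The two added units keep the bounds positive, as [lyapunov_add] asks. *)
pose r : 'cV[R]_n := (- alpha) *: grad f xstar.
pose W k := V (sig_w1 (s k) - xstar) (sig_w2 (s k)).
pose t := Num.sqrt (V r 0) + 1; pose s0 := Num.sqrt (W 0%N) + 1.
have Vge0 a1 a2 : 0 <= V a1 a2 by exact: lyapunov_ge0.
have sq1 (x : R) : 0 <= x -> x <= (Num.sqrt x + 1) ^+ 2.
  move=> x0; rewrite -{1}(sqr_sqrtr x0).
  rewrite ler_pXn2r ?nnegrE ?addr_ge0 ?sqrtr_ge0 //.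
  by rewrite lerDl.
have t0 : 0 < t by rewrite ltr_wpDl ?sqrtr_ge0.
have s0p : 0 < s0 by rewrite ltr_wpDl ?sqrtr_ge0.
pose tau := t / (rho - 1).
have tau0 : 0 < tau by rewrite divr_gt0 // subr_gt0.
have tauE : rho * tau = tau + t by rewrite /tau; field; rewrite subr_eq0 gt_eqF.
(* The solution of [b_(k+1) = rho b_k + t] with [b_0 = s0]. *)
pose b k := rho ^+ k * (s0 + tau) - tau.
have b0 k : 0 < b k.
  rewrite /b subr_gt0; apply: (@lt_le_trans _ _ (s0 + tau)).
    by rewrite ltrDr.
  by rewrite ler_peMl ?exprn_ege1 ?ltW // addr_gt0.
have bS k : b k.+1 = rho * b k + t by rewrite /b exprS mulrBr tauE; ring.
have Wb k : W k <= b k ^+ 2.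
  elim: k => [|k IH].
    by rewrite /b expr0 mul1r addrK; exact: (sq1 (W 0%N) (Vge0 _ _)).
  have [a1 [a2 [e1 e2 le]]] := perturbed_step (tr k).
  rewrite /W e1 -/r e2 -[a2]addr0 bS; apply: lyapunov_add => //.
  - by rewrite mulr_gt0 // (lt_trans ltr01).
  - by apply: le_trans le _; rewrite exprMn ler_wpM2l // sqr_ge0.
  - exact: (sq1 (V r 0) (Vge0 _ _)).
exists (K * (Num.sqrt (lambda_min T))^-1 * (s0 + tau)) => k.
have xE : sig_x (s k) - xstar = sig_w1 (s k) - xstar
    - Lap *m (delta *: (sig_w1 (s k) - xstar) + eta *: sig_w2 (s k)).
  have [_ _ h3 h4 [_ h6]] := tr k.
  rewrite h3 h6 h4 scalerBr [delta *: _ - _ + _]addrAC mulmxBr.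
  rewrite -[Lap *m (delta *: xstar)]scalemxAr Lap_consensus scaler0 subr0.
  by rewrite addrAC.
rewrite xE; apply: le_trans (output_gain _ _) _.
rewrite -!mulrA; apply: ler_wpM2l; first exact: spectral_norm_ge0.
have q0 : 0 < Num.sqrt (lambda_min T) by rewrite sqrtr_gt0.
rewrite mulrC ler_pdivlMr // -sqrtrM ?addr_ge0 ?sqn_ge0 // mulrC.
have /andP[lo _] := bnd (sig_w1 (s k) - xstar) (sig_w2 (s k)).
apply: le_trans (ler_wsqrtr (le_trans lo (Wb k))) _.
by rewrite sqrtr_sqr gtr0_norm // /b mulrC gerBl ltW.
Qed.

End Trajectories.

Theorem theorem2 (R : realType) (n : nat) (f : 'I_n -> R -> R) (xopt : R)
    (m L : R) (G : wdigraph R n) (alpha beta gamma delta rho : R)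
    (f_convex : forall i, convex_function [set: R^o] (f i))
    (f_diff : forall i x, derivable (f i) x 1)
    (xopt_min : unique_minimizer f xopt)
    (m_gt0 : 0 < m) (m_le_L : m <= L)
    (f_sector : forall i, sector_bounded m L xopt (f i))
    (G_sc : strongly_connected G)
    (G_wb : weight_balanced G)
    (sigma_lt1 : spectral_norm (1%:M - avg - laplacian G) < 1)
    (params : 4 * beta * delta <= gamma ^+ 2)
    (rho_ge0 : 0 <= rho)
    (P Q : 'M[R]_2) (lambda0 lambda1 : R)
    (P_pd : posdefmx P) (Q_pd : posdefmx Q)
    (lambda0_ge0 : 0 <= lambda0) (lambda1_ge0 : 0 <= lambda1)
    (lmiP : negsemidefmx (lmi_p alpha rho m L lambda0 P))
    (lmiQ : negsemidefmx
       (lmi_q alpha (zeta_of beta gamma delta) delta (eta_of beta gamma delta)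
          (spectral_norm (1%:M - avg - laplacian G))
          rho m L lambda0 lambda1 Q)) :
  let z := zeta_of beta gamma delta in
  let e := eta_of beta gamma delta in
  let T := tensmx P avg + tensmx Q (1%:M - avg) : 'M[R]_(2 * n) in
  [/\ rho <= 1 ->
        exists s_star, Gm_fixed_point f (laplacian G) alpha z delta e s_star,
      forall s_star, Gm_fixed_point f (laplacian G) alpha z delta e s_star ->
      forall s, Gm_trajectory f (laplacian G) alpha z delta e s ->
      forall k, enorm (state (s k) - state s_star) <=
        Num.sqrt (condnum T) * rho ^+ k * enorm (state (s 0%N) - state s_star) &
      forall s, alg1_run f (laplacian G) alpha z delta e s ->
      exists C, forall k, enorm (sig_x (s k) - xopt *: ones) <= C * rho ^+ k].
Proof.
move=> z e T.
have n_gt0 : (0 < n)%N.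
  (* Without agents the objective vanishes, so every point minimizes it. *)
  rewrite lt0n; apply/negP => /eqP n0.
  move: f xopt_min {f_convex f_diff f_sector G sigma_lt1 G_sc G_wb lmiQ T}.
  rewrite n0 => g gmin.
  have all_min x : x = xopt by apply/gmin => t; rewrite !big_ord0.
  by have /eqP := all_min (xopt + 1); rewrite -subr_eq0 addrC addKr oner_eq0.
have xopt_stat : \sum_(i < n) derive1 (f i) xopt = 0.
  apply: sum_derive_at_min => //; exact: (xopt_min xopt).2.
have Lap1 := laplacian_ones G.
split.
- move=> rho_le1.
  have [s fp _] := optimal_fixed_point n_gt0 G_wb Lap1 sigma_lt1 xopt_stat
    rho_ge0 lambda1_ge0 Q_pd lmiQ rho_le1.
  by exists s.
- move=> s0 fp s tr k.
  exact: (Gm_linear_rate n_gt0 G_wb Lap1 m_gt0 m_le_L f_sector xopt_stat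
    rho_ge0 lambda0_ge0 lambda1_ge0 P_pd Q_pd lmiP lmiQ k fp tr).
- move=> s /(projected_run_trajectory n_gt0 Lap1) tr.
  have [rho_le1|rho_gt1] := leP rho 1.
    exact: (Gm_output_rate_le1 n_gt0 G_wb Lap1 sigma_lt1 m_gt0 m_le_L f_sector
      xopt_stat rho_ge0 lambda0_ge0 lambda1_ge0 P_pd Q_pd lmiP lmiQ rho_le1 tr).
  exact: (Gm_output_rate_gt1 n_gt0 G_wb Lap1 f_sector
    lambda0_ge0 lambda1_ge0 P_pd Q_pd lmiP lmiQ rho_gt1 tr).
Qed.
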